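(* Let $\Gamma=(V,E)$ be a finite graph, let $H_\Gamma$ be the right angled Artin group associated to $\Gamma$, and let $r\ge 2$ be an integer. Then $$z_r(\Gamma)\ \le\ \mathsf{TC}_r(H_\Gamma).$$
   Context: For a finite graph $\Gamma=(V,E)$ (edges join distinct vertices), the right angled Artin group $H_\Gamma$ is given by the presentation with generators $v\in V$ and relations $vw=wv$ for each edge $(v,w)\in E$. A clique of $\Gamma$ is a set of vertices any two of which are connected by an edge (the empty set is allowed). For $r\ge 2$, $z_r(\Gamma)$ is the maximal total cardinality $\sum_{i=1}^r|C_i|$ of $r$ cliques $C_1,\dots,C_r\subset V$ (not necessarily distinct) with empty total intersection $\bigcap_{i=1}^r C_i=\emptyset$. For a path-connected topological space $X$ and an integer $r\ge 2$, let $X^I$ be the space of continuous paths $\gamma:I=[0,1]\to X$ with the compact-open topology, and let $p_r:X^I\to X^r$ be the fibration $p_r(\gamma)=\left(\gamma(0),\gamma\left(\tfrac{1}{r-1}\right),\dots,\gamma\left(\tfrac{r-2}{r-1}\right),\gamma(1)\right)$. $\mathsf{TC}_r(X)$ is the minimal integer $k\ge 0$ such that $X^r$ can be covered by $k+1$ open subsets $U_0,\dots,U_k$ with the property that for each $i$ there is a continuous map $s_i:U_i\to X^I$ such that $p_r\circ s_i$ is the inclusion $U_i\hookrightarrow X^r$; if no such $k$ exists, $\mathsf{TC}_r(X)=\infty$. It is a homotopy invariant, and for a discrete group $\pi$, $\mathsf{TC}_r(\pi):=\mathsf{TC}_r(K(\pi,1))$, where $K(\pi,1)$ is an Eilenberg-MacLane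 (CW) space. *)

(* Defs.v *)
From HB Require Import structures.
From mathcomp Require Import all_boot all_order all_algebra.
From mathcomp Require Import generic_quotient.
From mathcomp Require Import all_classical all_reals topology ereal.

Set Implicit Arguments.
Unset Strict Implicit.
Unset Printing Implicit Defensive.

Import Order.TTheory GRing.Theory Num.Theory.
Import numFieldTopology.Exports.

Local Open Scope classical_set_scope.
Local Open Scope ring_scope.
Local Open Scope quotient_scope.

(* The letter (v, true) stands for the generator v, (v, false) for v^-1. *)
Definition word (V : Type) : Type := seq (V * bool).

Definition word_inv (V : Type) (w : word V) : word V :=
  rev [seq (a.1, ~~ a.2) | a <- w].

Section PresentedGroup.
Variables (V : choiceType) (S : word V -> word V -> Prop).

Inductive word_eqv : word V -> word V -> Prop :=
| word_eqv_refl x : word_eqv x x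
| word_eqv_sym x y : word_eqv x y -> word_eqv y x
| word_eqv_trans y x z : word_eqv x y -> word_eqv y z -> word_eqv x z
| word_eqv_cat x x' y y' :
    word_eqv x x' -> word_eqv y y' -> word_eqv (x ++ y) (x' ++ y')
| word_eqv_cancel v b : word_eqv [:: (v, b); (v, ~~ b)] [::]
| word_eqv_rel x y : S x y -> word_eqv x y.

Definition word_eqvb : rel (seq (V * bool)) := fun x y => `[< word_eqv x y >].

Lemma word_eqvb_refl : reflexive word_eqvb.
Proof. by move=> x; apply/asboolP; exact: word_eqv_refl. Qed.

Lemma word_eqvb_sym : symmetric word_eqvb.
Proof. by move=> x y; apply/asboolP/asboolP; exact: word_eqv_sym. Qed.

Lemma word_eqvb_trans : transitive word_eqvb.
Proof.
move=> y x z /asboolP xy /asboolP yz.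
by apply/asboolP; exact: word_eqv_trans xy yz.
Qed.

Canonical word_eqvb_equiv :=
  EquivRel word_eqvb word_eqvb_refl word_eqvb_sym word_eqvb_trans.

Definition presented_group : Type := {eq_quot word_eqvb}.
HB.instance Definition _ := Choice.on presented_group.
HB.instance Definition _ := EqQuotient.on presented_group.

Definition word_class (w : word V) : presented_group := \pi_presented_group w.

Lemma word_classP x y : reflect (word_eqv x y) (word_class x == word_class y).
Proof. by rewrite /word_class eqmodE; exact: asboolP. Qed.

Lemma word_class_repr (a : presented_group) : word_class (repr a) = a.
Proof. exact: reprK. Qed.

Lemma repr_word_class x : word_eqv (repr (word_class x)) x.
Proof. by apply/word_classP; rewrite word_class_repr. Qed.

Definition pgroup_one : presented_group := word_class [::].
Definition pgroup_mul (a b : presented_group) : presented_group :=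
  word_class (repr a ++ repr b).
Definition pgroup_inv (a : presented_group) : presented_group :=
  word_class (word_inv (repr a)).

Lemma word_invK (x : word V) : word_inv (word_inv x) = x.
Proof.
rewrite /word_inv map_rev revK -map_comp -[RHS]map_id.
by apply: eq_map => -[v b] /=; rewrite negbK.
Qed.

Lemma word_eqv_mulV x : word_eqv (x ++ word_inv x) [::].
Proof.
elim: x => [|[v b] x IH]; first exact: word_eqv_refl.
rewrite /word_inv /= rev_cons -cats1 -/(word_inv x).
rewrite -[_ :: _]/([:: (v, b)] ++ (x ++ (word_inv x ++ [:: (v, ~~ b)]))).
rewrite (catA x); apply: (word_eqv_trans _ (word_eqv_cancel v b)).
apply: (word_eqv_cat (word_eqv_refl [:: (v, b)])).
exact: (word_eqv_cat IH (word_eqv_refl _)).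
Qed.

Lemma word_eqv_mulVl x : word_eqv (word_inv x ++ x) [::].
Proof. by rewrite -{2}[x]word_invK; exact: word_eqv_mulV. Qed.

Lemma pgroup_mulE x y :
  pgroup_mul (word_class x) (word_class y) = word_class (x ++ y).
Proof.
by apply/eqP/word_classP; apply: word_eqv_cat; exact: repr_word_class.
Qed.

Lemma pgroup_mulA : associative pgroup_mul.
Proof.
move=> a b c.
rewrite -[a]word_class_repr -[b]word_class_repr -[c]word_class_repr.
by rewrite !pgroup_mulE catA.
Qed.

Lemma pgroup_mul1 : left_id pgroup_one pgroup_mul.
Proof. by move=> a; rewrite -[a]word_class_repr pgroup_mulE. Qed.

Lemma pgroup_mulr1 : right_id pgroup_one pgroup_mul.
Proof. by move=> a; rewrite -[a]word_class_repr pgroup_mulE cats0. Qed.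

Lemma pgroup_mulVl : left_inverse pgroup_one pgroup_inv pgroup_mul.
Proof.
move=> a; rewrite -[X in pgroup_mul _ X]word_class_repr pgroup_mulE.
by apply/eqP/word_classP; exact: word_eqv_mulVl.
Qed.

Lemma pgroup_mulVr : right_inverse pgroup_one pgroup_inv pgroup_mul.
Proof.
move=> a; rewrite -[X in pgroup_mul X _]word_class_repr pgroup_mulE.
by apply/eqP/word_classP; exact: word_eqv_mulV.
Qed.

HB.instance Definition _ := isGroup.Build presented_group
  pgroup_mulA pgroup_mul1 pgroup_mulr1 pgroup_mulVl pgroup_mulVr.

End PresentedGroup.

Definition raag_rel (V : finType) (E : rel V) (x y : word V) : Prop :=
  exists v w : V, [/\ E v w, x = [:: (v, true); (w, true)]
                          & y = [:: (w, true); (v, true)]].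

Definition raag (V : finType) (E : rel V) : groupType :=
  presented_group (raag_rel E).

Definition clique (V : finType) (E : rel V) (C : {set V}) : bool :=
  [forall v in C, forall w in C, (v != w) ==> E v w].

Definition zr (V : finType) (E : rel V) (r : nat) : nat :=
  (\max_(C : {ffun 'I_r -> {set V}} |
         [forall i, clique E (C i)] && (\bigcap_i C i == finset.set0)%SET)
     \sum_i #|C i|)%N.

Definition unitI (R : realType) : topologicalType := `[0 : R, 1]%classic.

Lemma clamp_subproof (R : realType) (x : R) :
  Num.max 0 (Num.min x 1) \in `[0 : R, 1]%classic.
Proof. by rewrite inE /= in_itv /= le_max lexx ge_max ler01 ge_min lexx orbT. Qed.

(* Used below only at points of [0, 1], where it is the identity (clampK). *)
Definition clamp (R : realType) (x : R) : unitI R :=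
  exist (fun y => y \in `[0 : R, 1]%classic) _ (clamp_subproof x).

Lemma clampK (R : realType) (x : R) : 0 <= x <= 1 -> set_val (clamp x) = x.
Proof. by move=> /andP[x0 x1]; rewrite /clamp set_valE /= min_l// max_r. Qed.

Definition cube (R : realType) (n : nat) : topologicalType :=
  {ptws 'I_n -> unitI R}.

Definition cube_bd (R : realType) (n : nat) : set (cube R n) :=
  [set u | exists i : 'I_n, u i = clamp 0 \/ u i = clamp 1].

Definition path_space (R : realType) (X : topologicalType) : Type :=
  continuousType (unitI R) X.
HB.instance Definition _ (R : realType) (X : topologicalType) :=
  Topological.copy (path_space R X)
    (initial_topology
      (fun g : path_space R X => (g : unitI R -> X) : {compact-open, unitI R -> X})).

Definition path_connected (R : realType) (X : topologicalType) : Prop :=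
  forall x y : X, exists g : path_space R X, g (clamp 0) = x /\ g (clamp 1) = y.

Definition homotopic_rel (R : realType) (X Y : topologicalType) (A : set Y)
    (f g : Y -> X) : Prop :=
  exists H : unitI R * Y -> X,
    [/\ continuous H,
        forall y, H (clamp 0, y) = f y,
        forall y, H (clamp 1, y) = g y
      & forall t y, A y -> H (t, y) = f y].

Definition is_loop (R : realType) (X : topologicalType) (x0 : X)
    (f : unitI R -> X) : Prop :=
  [/\ continuous f, f (clamp 0) = x0 & f (clamp 1) = x0].

Definition loop_concat (R : realType) (X : topologicalType)
    (f g : unitI R -> X) : unitI R -> X :=
  fun t => if set_val t <= 2^-1 then f (clamp (2 * set_val t))
           else g (clamp (2 * set_val t - 1)).

(* pi_1 (X, x0) is isomorphic to G: phi is constant exactly on the classes of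
   loops up to homotopy rel endpoints, and the induced map on the quotient is
   a bijective morphism. *)
Definition pi1_iso (R : realType) (X : topologicalType) (x0 : X)
    (G : groupType) : Prop :=
  exists phi : (unitI R -> X) -> G,
    [/\ forall f g, is_loop x0 f -> is_loop x0 g ->
          (phi f = phi g <->
           homotopic_rel R [set clamp 0; clamp 1] f g),
        forall f g, is_loop x0 f -> is_loop x0 g ->
          phi (loop_concat f g) = (phi f * phi g)%g
      & forall a : G, exists f, is_loop x0 f /\ phi f = a].

Definition pi_trivial (R : realType) (X : topologicalType) (x0 : X)
    (n : nat) : Prop :=
  forall f : cube R n -> X, continuous f ->
    (forall u, cube_bd u -> f u = x0) ->
    homotopic_rel R (@cube_bd R n) f (cst x0).

(* A CW structure given by its characteristic maps, with the cube [0,1]^n as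
   model of the n-disc.  Since X is Hausdorff, the cubes are compact and the
   image of the boundary of a cube misses the open cell, each characteristic map
   is automatically a homeomorphism from the open cube onto the open cell. *)
Definition is_CW (R : realType) (X : topologicalType) : Prop :=
  hausdorff_space X /\
  exists (J : Type) (dim : J -> nat) (Phi : forall j, cube R (dim j) -> X),
    let cell j := Phi j @` ~` @cube_bd R (dim j) in
    [/\ forall j, continuous (Phi j),
        forall j, {in ~` @cube_bd R (dim j) &, injective (Phi j)},
        trivIset setT cell /\ \bigcup_j cell j = setT,
        forall j, exists F : set J,
          [/\ finite_set F, forall k, F k -> (dim k < dim j)%N
            & Phi j @` @cube_bd R (dim j) `<=` \bigcup_(k in F) cell k]
      & forall A : set X, (forall j, closed (Phi j @^-1` A)) -> closed A].

(* By homotopy invariance, the TC_r of the group G is TC_r X for any such X. *)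
Definition is_K1 (R : realType) (X : topologicalType) (G : groupType) : Prop :=
  [/\ is_CW R X, path_connected R X
    & exists x0 : X, pi1_iso R x0 G /\
        forall n : nat, (2 <= n)%N -> pi_trivial R x0 n].

(* As j < r, the point j / (r - 1) lies in [0, 1]. *)
Definition path_eval (R : realType) (X : topologicalType) (r : nat)
    (g : path_space R X) : {ptws 'I_r -> X} :=
  fun j => g (clamp (j%:R / r.-1%:R)).
Arguments path_eval {R X} r g.

Definition TC_le (R : realType) (r : nat) (X : topologicalType) (k : nat) : Prop :=
  exists U : 'I_k.+1 -> set {ptws 'I_r -> X},
    [/\ forall i, open (U i),
        \bigcup_i U i = setT
      & forall i, exists s : U i -> path_space R X,
          continuous s /\ forall u : U i, path_eval r (s u) = set_val u].

(* The infimum of a set of natural numbers: its least element, or +oo if the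
   set is empty. *)
Definition TC (R : realType) (r : nat) (X : topologicalType) : \bar R :=
  ereal_inf [set k%:R%:E | k in [set k : nat | TC_le R r X k]].

(* Main.v *)
Require Import Defs.
From HB Require Import structures.
From mathcomp Require Import all_boot all_order all_algebra.
From mathcomp Require Import fingroup perm.
From mathcomp Require Import generic_quotient.
From mathcomp Require Import all_classical all_reals topology ereal normedtype.
From mathcomp Require Import ring lra zify.

Set Implicit Arguments.
Unset Strict Implicit.
Unset Printing Implicit Defensive.

Import Order.TTheory GRing.Theory Num.Theory.
Import numFieldTopology.Exports numFieldNormedType.Exports.

Local Open Scope ring_scope.

(** The bound comes from tori in X. A clique C generates a free abelian
subgroup of the Artin group, and as X is aspherical there is a continuous map
from R^C to X that is Z^C-periodic and runs through the loop of the generator v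
along the v-axis ([torus_map]). It is built skeleton by skeleton: the squares
are filled because the generators commute ([square_filling]), the cubes of
dimension at least 3 because the higher homotopy groups vanish
([sphere_filling]). Cliques C_j of total cardinality N thus give a Z^N-periodic
map F from R^N to X^r.

Let k + 1 open sets with sections cover X^r and let W_i be their preimages under
F. A path in W_i from x to x + a, with a in Z^N, has loops as its images under
the r components of F, and the section is a free homotopy between any two of
these loops. Freely homotopic loops are conjugate, so they agree in the
abelianization Z^V ([free_homotopy_class]). There the j-th loop is the part
a_j of a that belongs to C_j ([line_class]), and it is supported in C_j. All
a_j are therefore equal and supported in the empty intersection of the
cliques, hence a = 0.

It remains to see that R^N has no Z^N-invariant open cover by at most N sets in
which no path joins two distinct points of a Z^N-orbit ([covering_dimension]).
Such sets can be developed: there is a function from W_i to Z^N that is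
constant along paths and commutes with translations. A fine lattice, each point
of which is coloured by a set W_i that contains a neighbourhood of it, then
yields an equivariant map h from lattice points to Z^N that takes equal values at
neighbours of equal colour. With at most N colours every simplex of the Kuhn
triangulation of R^N has two vertices of the same colour, so h collapses it to
a simplex of volume 0. But the sum of the signed volumes of the image simplices,
over a fundamental domain, is the evaluation of a cup product of N classes of
degree 1 on the fundamental class of the torus. It is the same for every
equivariant map, and is not 0 for the identity ([lattice_colouring]). *)

(** * Cup products of one-dimensional cocycles on a discrete torus *)
Section CupProducts.
Variables (T : finZmodType) (n : nat) (e : 'I_n.+1 -> T).

(** [a i x] is the value on the edge from [x] to [x + e i]. *)
Definition cochain := 'I_n.+1 -> T -> int.

(** The two edge paths around each unit square have the same value, so that the
value of the diagonal of a square is well defined. *)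
Definition closed_cochain (a : cochain) :=
  forall x i j, a i x + a j (x + e i) = a j x + a i (x + e j).

Definition coboundary (g : T -> int) : cochain := fun i x => g (x + e i) - g x.

(** The simplex of the Kuhn triangulation attached to [x] and [s] has the
vertices [kuhn_vertex x s p], for p = 0, ..., n + 1: it walks from [x] to the
opposite corner of its unit cube, in the order of directions given by [s]. *)
Definition kuhn_vertex (x : T) (s : {perm 'I_n.+1}) (p : nat) : T :=
  x + \sum_(l < n.+1 | (l < p)%N) e (s l).

(** Evaluation on the fundamental cycle of the torus. *)
Definition kuhn_sum (f : T -> {perm 'I_n.+1} -> int) : int :=
  \sum_x \sum_(s : {perm 'I_n.+1}) (-1) ^+ s * f x s.

(** A cup product of the function [g] and of the [n] cochains [b], evaluated on
the edge path of the simplex with its edge [k] left out; [g] is taken at the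
vertex [p]. *)
Definition face_cup (g : T -> int) (b : 'I_n -> cochain) (p : nat)
    (k : 'I_n.+1) (x : T) (s : {perm 'I_n.+1}) : int :=
  g (kuhn_vertex x s p) *
  \prod_(j < n) b j (s (lift k j)) (kuhn_vertex x s (lift k j)).

Lemma kuhn_vertex0 x s : kuhn_vertex x s 0 = x.
Proof. by rewrite /kuhn_vertex big_pred0 ?addr0. Qed.

Lemma kuhn_vertexS x s (k : 'I_n.+1) :
  kuhn_vertex x s k.+1 = kuhn_vertex x s k + e (s k).
Proof.
rewrite /kuhn_vertex -addrA; congr (_ + _).
rewrite (bigD1 k) //= addrC; congr (_ + _); apply: eq_bigl => l.
by rewrite ltnS [RHS]ltn_neqAle andbC.
Qed.

Lemma kuhn_sumD f g :
  kuhn_sum (fun x s => f x s + g x s) = kuhn_sum f + kuhn_sum g.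
Proof.
rewrite -big_split; apply: eq_bigr => x _; rewrite -big_split /=.
by apply: eq_bigr => s _; rewrite mulrDr.
Qed.

Lemma kuhn_sum_sum (I : finType) (f : I -> T -> {perm 'I_n.+1} -> int) :
  kuhn_sum (fun x s => \sum_i f i x s) = \sum_i kuhn_sum (f i).
Proof.
rewrite exchange_big; apply: eq_bigr => x _; rewrite exchange_big /=.
by apply: eq_bigr => s _; rewrite mulr_sumr.
Qed.

Lemma kuhn_sumZ c f : kuhn_sum (fun x s => c * f x s) = c * kuhn_sum f.
Proof.
rewrite mulr_sumr; apply: eq_bigr => x _; rewrite mulr_sumr.
by apply: eq_bigr => s _; rewrite mulrCA.
Qed.

Lemma eq_kuhn_sum f g : (forall x s, f x s = g x s) -> kuhn_sum f = kuhn_sum g.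
Proof.
by move=> fg; apply: eq_bigr => x _; apply: eq_bigr => s _; rewrite fg.
Qed.

Lemma kuhn_sum_alternating f (t : {perm 'I_n.+1}) : odd_perm t ->
  (forall x s, f x (t * s)%g = f x s) -> kuhn_sum f = 0.
Proof.
move=> odd_t ft; suff /eqP : kuhn_sum f = - kuhn_sum f.
  by rewrite -subr_eq0 opprK -mulr2n mulrn_eq0 /= => /eqP.
rewrite -sumrN; apply: eq_bigr => x _.
rewrite [LHS](reindex_inj (mulgI t)) -sumrN; apply: eq_bigr => s _ /=.
by rewrite odd_permM odd_t ft addTb signrN mulNr.
Qed.

Lemma kuhn_vertex_tperm x s (k k' : 'I_n.+1) (p : nat) :
  k' = k.+1 :> nat -> p != k' ->
  kuhn_vertex x (tperm k k' * s) p = kuhn_vertex x s p.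
Proof.
move=> kk' pk'; rewrite /kuhn_vertex; congr (_ + _).
rewrite [RHS](reindex_inj (@perm_inj _ (tperm k k'))) /=.
apply: eq_big => [l|l _]; last by rewrite permM.
case: tpermP => [->|->|//]; lia.
Qed.

(** Moving the omitted edge past a neighbour changes the sign: the sum of the two
terms contains the value of a closed cochain on a two-edge path, which is
invariant under the exchange of the two directions, while that exchange reverses
the orientation of the simplex. The vertex between the two edges moves, so [g]
must not be evaluated there. *)
Lemma face_cup_swap g b (p : nat) (k k' : 'I_n.+1) :
  k' = k.+1 :> nat -> p != k' -> (forall j, closed_cochain (b j)) ->
  kuhn_sum (face_cup g b p k') = - kuhn_sum (face_cup g b p k).
Proof.
move=> kk' pk' bc; apply/eqP; rewrite -addr_eq0 -kuhn_sumD; apply/eqP.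
apply: (@kuhn_sum_alternating _ (tperm k k')) => [|x s].
  by rewrite odd_tperm -val_eqE /= kk' neq_ltn ltnSn.
have kn : (k < n)%N by have := ltn_ord k'; rewrite kk' ltnS.
pose j0 := Ordinal kn.
have lk : lift k j0 = k' by apply: val_inj; rewrite /= /bump leqnn kk'.
have lk' : lift k' j0 = k by apply: val_inj; rewrite /= /bump kk' ltnn.
have ll (j : 'I_n) : j != j0 -> lift k' j = lift k j.
  rewrite -val_eqE /= => jk; apply: val_inj; rewrite /= /bump kk'.
  by rewrite [in RHS]leq_eqVlt [in RHS]eq_sym (negPf jk).
have E r : face_cup g b p k' x r + face_cup g b p k x r =
    g (kuhn_vertex x r p) *
    ((b j0 (r k) (kuhn_vertex x r k) + b j0 (r k') (kuhn_vertex x r k')) *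
     \prod_(j < n | j != j0)
       b j (r (lift k j)) (kuhn_vertex x r (lift k j))).
  rewrite /face_cup -mulrDr (bigD1 j0) // lk'.
  rewrite [X in _ + X](bigD1 j0) // lk mulrDl; congr (_ * (_ * _ + _)).
  by apply: eq_bigr => j jj0; rewrite ll.
rewrite !E; congr (_ * (_ * _)).
- by rewrite kuhn_vertex_tperm.
- rewrite kk' !kuhn_vertexS !permM !tpermL !tpermR kuhn_vertex_tperm //.
    exact: bc.
  by rewrite kk' neq_ltn ltnSn.
apply: eq_bigr => j jj0.
have h : (lift k j != k) && (lift k j != k').
  by rewrite eq_sym neq_lift -lk (inj_eq (@lift_inj _ k)).
case/andP: h => h1 h2; rewrite permM tpermD; try by rewrite eq_sym.
by rewrite kuhn_vertex_tperm.
Qed.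

(** The cyclic shift sending l to l + 1. *)
Definition rot_perm : {perm 'I_n.+1} := lift_perm ord_max ord0 1.

Lemma odd_rot_perm : odd_perm rot_perm = odd n.
Proof. by rewrite odd_lift_perm odd_perm1 !addbF. Qed.

Lemma rot_permE (j : 'I_n) : rot_perm (lift ord_max j) = lift ord0 j.
Proof. by rewrite lift_perm_lift perm1. Qed.

Lemma kuhn_vertex_rot x (s : {perm 'I_n.+1}) p : (p <= n)%N ->
  kuhn_vertex (x + e (s ord0)) (rot_perm * s) p = kuhn_vertex x s p.+1.
Proof.
elim: p => [|p IH] pn.
  by rewrite kuhn_vertex0 (kuhn_vertexS _ _ ord0) kuhn_vertex0.
have pn1 : (p < n.+1)%N by rewrite ltnS ltnW.
rewrite (kuhn_vertexS _ _ (Ordinal pn1)) IH; last exact: ltnW.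
rewrite (kuhn_vertexS x s (Ordinal (pn : (p.+1 < n.+1)%N))) permM.
congr (_ + e (s _)).
have -> : Ordinal pn1 = lift ord_max (Ordinal pn).
  by apply: val_inj; rewrite /= /bump leqNgt pn.
by rewrite rot_permE; apply: val_inj.
Qed.

(** The face of a simplex opposite to its first vertex is the face, opposite to
the last vertex, of the simplex that starts one step further: on the torus these
two faces cancel in the boundary. *)
Lemma face_cup_rot g b (p : nat) : (p <= n)%N ->
  kuhn_sum (face_cup g b p.+1 ord0) =
  (-1) ^+ n * kuhn_sum (face_cup g b p ord_max).
Proof.
move=> pn; rewrite -kuhn_sumZ /kuhn_sum exchange_big [RHS]exchange_big /=.
rewrite [RHS](reindex_inj (mulgI rot_perm)) /=; apply: eq_bigr => s _.
rewrite [RHS](reindex_inj (addIr (e (s ord0)))) /=; apply: eq_bigr => x _.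
rewrite odd_permM odd_rot_perm signr_addb signr_odd.
rewrite [RHS]mulrA [X in _ = X * _]mulrAC -expr2 sqrr_sign mul1r.
congr (_ * (g _ * _)); first by rewrite kuhn_vertex_rot.
apply: eq_bigr => j _.
rewrite permM rot_permE lift_max lift0 kuhn_vertex_rot //.
exact: ltnW.
Qed.

(** Stokes on the torus. The coboundary contributes the values of [g] at both
ends of the edge [k]. The omitted edge of the first term is moved down to
position 0, carried around the torus to the last position, and moved down from
there to [k]; the product of all the signs is 1, and the two terms cancel. *)
Lemma cup_coboundary g b (k : 'I_n.+1) : (forall j, closed_cochain (b j)) ->
  kuhn_sum (fun x s => coboundary g (s k) (kuhn_vertex x s k) *
    \prod_(j < n) b j (s (lift k j)) (kuhn_vertex x s (lift k j))) = 0.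
Proof.
move=> bc.
have down (i : nat) (ik : (i <= k)%N) (i' : 'I_n.+1) : i' = i :> nat ->
    kuhn_sum (face_cup g b k.+1 i') =
    (-1) ^+ i * kuhn_sum (face_cup g b k.+1 ord0).
  elim: i ik i' => [|i IH] ik i' i'E.
    by rewrite expr0 mul1r; congr (kuhn_sum (face_cup _ _ _ _)); apply: val_inj.
  have ik' : (i < n.+1)%N by rewrite (leq_trans ik) // ltnW.
  rewrite (@face_cup_swap g b _ (Ordinal ik') i') //; last first.
    by rewrite i'E eqSS neq_ltn ik orbT.
  by rewrite (IH (ltnW ik)) // exprS mulN1r mulNr.
have up (i : nat) (ik : (k + i <= n)%N) (i' : 'I_n.+1) : i' = (k + i)%N :> nat ->
    kuhn_sum (face_cup g b k i') =
    (-1) ^+ i * kuhn_sum (face_cup g b k k).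
  elim: i ik i' => [|i IH] ik i' i'E.
    rewrite expr0 mul1r; congr (kuhn_sum (face_cup _ _ _ _)).
    by apply: val_inj; rewrite /= i'E addn0.
  have ik' : (k + i < n.+1)%N by rewrite ltnS ltnW // -addnS.
  have e1 : i' = (Ordinal ik').+1 :> nat by rewrite i'E addnS.
  have e2 : (k : nat) != i' by rewrite i'E neq_ltn -addSnnS leq_addr.
  rewrite (face_cup_swap g e1 e2 bc).
  by rewrite IH // ?exprS ?mulN1r ?mulNr // ltnW // -addnS.
transitivity (kuhn_sum (face_cup g b k.+1 k) +
              (-1) * kuhn_sum (face_cup g b k k)).
  rewrite -kuhn_sumZ -kuhn_sumD; apply: eq_kuhn_sum => x s.
  by rewrite /coboundary -kuhn_vertexS mulrBl mulN1r.
have kn : (k <= n)%N by rewrite -ltnS.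
rewrite (down k) // face_cup_rot // (up (n - k)%N); first last.
- by rewrite /= subnKC.
- by rewrite subnKC.
rewrite !mulrA -!exprD.
have -> : (k + n + (n - k) = n.*2)%N by lia.
by rewrite -signr_odd odd_double expr0 mul1r mulN1r subrr.
Qed.

(** When [c i] is the coboundary of the i-th coordinate of a map to Z^(n + 1), the
determinant is (n + 1)! times the signed volume of the image of the simplex. *)
Definition cochain_mx (c : 'I_n.+1 -> cochain) x (s : {perm 'I_n.+1}) : 'M[int]_n.+1 :=
  \matrix_(i, j) c i (s j) (kuhn_vertex x s j).

(** The determinant is an alternating sum of cup products, each of which has the
coboundary as a factor. *)
Lemma kuhn_sum_det_coboundary (c : 'I_n.+1 -> cochain) i0 g :
  (forall i, i != i0 -> closed_cochain (c i)) ->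
  (forall i x, c i0 i x = coboundary g i x) ->
  kuhn_sum (fun x s => \det (cochain_mx c x s)) = 0.
Proof.
move=> cc cg.
rewrite /determinant kuhn_sum_sum big1 // => t _.
rewrite (kuhn_sumZ ((-1) ^+ t)).
have := @cup_coboundary g (fun j => c ((t^-1)%g (lift (t i0) j))) (t i0).
have cc' j : closed_cochain (c ((t^-1)%g (lift (t i0) j))).
  apply: cc; rewrite -(inj_eq (@perm_inj _ t)) permKV eq_sym.
  exact: neq_lift.
move=> /(_ cc') H; rewrite -[RHS](mulr0 ((-1) ^+ t)); congr (_ * _).
rewrite -[RHS]H; apply: eq_kuhn_sum => x s.
rewrite (reindex_inj (@perm_inj _ (t^-1)%g)) /= (bigD1_ord (t i0)) //=.
rewrite permK mxE cg; congr (_ * _); apply: eq_bigr => j _.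
by rewrite mxE permKV.
Qed.

Lemma kuhn_sum_det_cohomologous (c c' : 'I_n.+1 -> cochain)
    (g : 'I_n.+1 -> T -> int) :
  (forall i, closed_cochain (c i)) -> (forall i, closed_cochain (c' i)) ->
  (forall i j x, c i j x = c' i j x + coboundary (g i) j x) ->
  kuhn_sum (fun x s => \det (cochain_mx c x s)) =
  kuhn_sum (fun x s => \det (cochain_mx c' x s)).
Proof.
move=> cc cc' cg.
(* The cochains are replaced one coordinate at a time. *)
pose mix (p : nat) (i : 'I_n.+1) : cochain := if (i < p)%N then c' i else c i.
have mixc p i : closed_cochain (mix p i).
  by rewrite /mix; case: ifP.
suff H p : (p <= n.+1)%N ->
    kuhn_sum (fun x s => \det (cochain_mx c x s)) =
    kuhn_sum (fun x s => \det (cochain_mx (mix p) x s)).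
  rewrite (H _ (leqnn _)); apply: eq_kuhn_sum => x s; congr (\det _).
  by apply/matrixP => i j; rewrite !mxE /mix ltn_ord.
elim: p => [|p IH] pn.
  by apply: eq_kuhn_sum => x s; congr (\det _); apply/matrixP => i j; rewrite !mxE.
rewrite (IH (ltnW pn)); pose i0 := Ordinal pn.
pose d i : cochain := if i == i0 then coboundary (g i0) else mix p i.
have d0 : kuhn_sum (fun x s => \det (cochain_mx d x s)) = 0.
  apply: (@kuhn_sum_det_coboundary _ i0 (g i0)) => [i ii0|i x].
    by rewrite /d (negPf ii0).
  by rewrite /d eqxx.
rewrite -[RHS]addr0 -d0 -kuhn_sumD; apply: eq_kuhn_sum => x s.
rewrite (@determinant_multilinear _ _ _ (cochain_mx (mix p.+1) x s)
  (cochain_mx d x s) i0 1 1) ?mul1r //.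
- by apply/rowP => j; rewrite !mxE /mix /d eqxx /= ltnn ltnSn !mul1r cg.
- apply/matrixP => i j; rewrite !mxE /mix ltnS leq_eqVlt.
  by rewrite -[(_ == p)%N]/(lift i0 i == i0) eq_sym (negPf (neq_lift _ _)).
- apply/matrixP => i j; rewrite !mxE /d.
  by rewrite eq_sym (negPf (neq_lift _ _)).
Qed.

Lemma kuhn_sum_det_unit :
  kuhn_sum (fun x s => \det (cochain_mx (fun i j _ => (i == j)%:R) x s)) != 0.
Proof.
have -> : kuhn_sum (fun x s =>
    \det (cochain_mx (fun i j _ => (i == j)%:R) x s)) =
    \sum_(x : T) \sum_(s : {perm 'I_n.+1}) 1.
  apply: eq_bigr => x _; apply: eq_bigr => s _.
  have -> : cochain_mx (fun i j _ => (i == j)%:R) x s = perm_mx (s^-1)%g.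
    by apply/matrixP => i j; rewrite !mxE -(canF_eq (permKV s)) eq_sym.
  by rewrite det_perm odd_permV -expr2 sqrr_sign.
by rewrite !sumr_const -!mulrnA pnatr_eq0 muln_eq0 negb_or -!lt0n
  (cardD1 0) // (cardD1 (1%g : 'S_n.+1)).
Qed.
End CupProducts.

(** An equivariant map h has the same periods as x / M, so M h has the same
signed volume on the torus (Z / M)^n as the identity. The n + 1 vertices of a
Kuhn simplex carry at most n colours; two of them have the same image under h,
which makes a sum of consecutive columns of the matrix vanish. *)
Lemma lattice_colouring (n k M : nat) (h : 'rV[int]_n -> 'rV[int]_n)
    (c : 'rV[int]_n -> 'I_k.+1) :
  (1 < M)%N -> (k < n)%N ->
  (forall x i, h (x + M%:Z *: delta_mx 0 i) = h x + delta_mx 0 i) ->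
  (forall x y : 'rV[int]_n, (forall i, ((y - x) 0 i == 0) || ((y - x) 0 i == 1)) ->
     c x = c y -> h x = h y) ->
  False.
Proof.
case: M => [//|[//|p]] _; case: n h c => [//|n] h c kn.
set M : nat := p.+2 => hM hc.
have hMz x (a : 'rV[int]_n.+1) : h (x + M%:Z *: a) = h x + a.
  have hMi y i (z : int) : h (y + M%:Z *: (z *: delta_mx 0 i)) = h y + z *: delta_mx 0 i.
    elim/int_rec: z y => [|m IH|m IH] y; first by rewrite scale0r scaler0 !addr0.
      by rewrite intS scalerDl scale1r scalerDr addrA IH hM addrA.
    rewrite -[in RHS](subrK (M%:Z *: delta_mx 0 i) y) hM intS opprD.
    rewrite !scalerDl !scaleN1r [in RHS]addrA addrK -IH.
    by rewrite scalerDr scalerN addrA.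
  rewrite [a]row_sum_delta.
  elim: (index_enum _) x => [|i r IH] x; first by rewrite big_nil scaler0 !addr0.
  by rewrite big_cons scalerDr addrA IH hMi addrA.
pose T := 'rV['Z_M]_n.+1.
pose proj (y : 'rV[int]_n.+1) : T := map_mx intr y.
pose rep (x : T) : 'rV[int]_n.+1 := map_mx (fun z : 'Z_M => (z : nat)%:Z) x.
have repK x : proj (rep x) = x.
  by apply/rowP => i; rewrite !mxE -pmulrn natr_Zp.
have repP y : exists q, y = rep (proj y) + M%:Z *: q.
  exists (map_mx (fun z => (z %/ M)%Z) y); apply/rowP => i; rewrite !mxE.
  set z := y 0 i.
  have zM : (z %% M)%Z = (`|(z %% M)%Z|%N)%:Z.
    by rewrite gez0_abs // modz_ge0.
  rewrite [in LHS](divz_eq z M) addrC mulrC; congr (_ + _).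
  rewrite [in RHS](divz_eq z M) intrD intrM.
  have -> : (M%:Z)%:~R = 0 :> 'Z_M by rewrite -pmulrn pchar_Zp.
  rewrite mulr0 add0r zM -pmulrn val_Zp_nat // modn_small //.
  by rewrite -ltz_nat -zM ltz_pmod.
pose e (i : 'I_n.+1) : T := delta_mx 0 i.
have projD y z : proj (y + z) = proj y + proj z.
  by apply/rowP => i; rewrite !mxE intrD.
have proj_delta i : proj (delta_mx 0 i) = e i.
  by apply/rowP => j; rewrite !mxE; case: (_ && _).
(* The edge differences of M h are periodic, hence a cochain on the torus; M h
   minus the identity is a periodic function, whose coboundary is [g]. *)
pose a i : cochain T n := fun j x =>
  M%:Z * (h (rep x + delta_mx 0 j) - h (rep x)) 0 i.
have aE i j y : a i j (proj y) = M%:Z * (h (y + delta_mx 0 j) - h y) 0 i.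
  rewrite /a; have [q {3 4}->] := repP y.
  by rewrite addrAC !hMz opprD addrACA subrr addr0.
pose g i (x : T) := M%:Z * (h (rep x)) 0 i - rep x 0 i.
have gE i y : g i (proj y) = M%:Z * (h y) 0 i - y 0 i.
  rewrite /g; have [q {3 4}->] := repP y.
  by rewrite hMz !mxE; ring.
have ac i : closed_cochain e (a i).
  move=> x j j'; rewrite -(repK x) -!proj_delta -!projD !aE.
  rewrite [in RHS]addrAC !mxE; ring.
have uc i : closed_cochain e (fun j _ => (i == j)%:R) by move=> x j j'; rewrite addrC.
have H := kuhn_sum_det_cohomologous (g := g) ac uc.
have := kuhn_sum_det_unit e; rewrite -H => [/eqP|{H} i j x]; last first.
  rewrite /coboundary -(repK x) -proj_delta -projD !aE !gE !mxE.
  rewrite eqxx /=; ring.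
apply; rewrite /kuhn_sum big1 // => x _; rewrite big1 // => s _.
apply/eqP; rewrite mulf_eq0; apply/orP; right.
pose v (q : nat) := rep x + \sum_(l < n.+1 | (l < q)%N) delta_mx 0 (s l).
have vS (j : 'I_n.+1) : v j.+1 = v j + delta_mx 0 (s j).
  rewrite /v -addrA; congr (_ + _); rewrite (bigD1 j) //= addrC.
  by congr (_ + _); apply: eq_bigl => l; rewrite ltnS [RHS]ltn_neqAle andbC.
have projv q : kuhn_vertex e x s q = proj (v q).
  rewrite projD repK; congr (_ + _); rewrite (big_morph proj projD (id1 := 0)).
    by apply: eq_bigr => l _; rewrite proj_delta.
  by apply/rowP => j; rewrite !mxE.
have [q1 [q2 [q12 q2n cq]]] : exists q1 q2 : nat,
    [/\ (q1 < q2)%N, (q2 <= n.+1)%N & c (v q1) = c (v q2)].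
  have : ~~ injectiveb (fun q : 'I_n.+2 => c (v q)).
    apply/negP => /injectiveP /leq_card; rewrite !card_ord; lia.
  case/injectivePn => q1 [q2 q12 cq].
  case: (ltngtP q1 q2) => [lt|lt|/val_inj/eqP]; last by rewrite (negPf q12).
    by exists q1, q2; split; rewrite // -ltnS.
  by exists q2, q1; split; rewrite // -ltnS.
have hv : h (v q1) = h (v q2).
  apply: hc cq => i.
  have -> : v q2 - v q1 =
      \sum_(l < n.+1 | (q1 <= l < q2)%N) delta_mx 0 (s l).
    rewrite /v opprD addrACA subrr add0r (bigID (fun l : 'I_n.+1 => (l < q1)%N)) /=.
    rewrite addrAC (eq_bigl (fun l : 'I_n.+1 => (l < q1)%N)) ?subrr ?add0r //.
      by apply: eq_bigl => l; rewrite -leqNgt andbC.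
    move=> l /=; lia.
  rewrite summxE; have [i12|i12] := boolP (q1 <= (s^-1)%g i < q2)%N.
    rewrite (bigD1 ((s^-1)%g i)) //= mxE permKV !eqxx big1 ?addr0 ?orbT //.
    move=> l /andP[_ li]; rewrite mxE eqxx /=; case: eqP => // il.
    by rewrite il permK eqxx in li.
  rewrite big1 // => l l12; rewrite mxE eqxx /=; case: eqP => // il.
  by rewrite il permK l12 in i12.
rewrite -det_tr; apply/det0P.
exists (\row_j (q1 <= j < q2)%N%:R).
  have q1n : (q1 < n.+1)%N by apply: leq_trans q12 _.
  by apply/eqP => /rowP/(_ (Ordinal q1n)); rewrite !mxE /= leqnn q12.
apply/rowP => i; rewrite !mxE.
transitivity (\sum_(j < n.+1 | (q1 <= j < q2)%N)
    (M%:Z * h (v j.+1) 0 i - M%:Z * h (v j) 0 i)).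
  rewrite [RHS]big_mkcond; apply: eq_bigr => j _; rewrite !mxE projv aE -vS !mxE.
  by case: ifP; rewrite ?mul0r // mul1r mulrBr.
transitivity (\sum_(q1 <= q < q2)
    (M%:Z * h (v q.+1) 0 i - M%:Z * h (v q) 0 i)).
  rewrite (big_nat_widen _ _ n.+1 xpredT) // big_geq_mkord.
  by apply: eq_bigl => j; rewrite andbC.
by rewrite (telescope_sumr (fun q => M%:Z * h (v q) 0 i) (ltnW q12)) hv subrr.
Qed.

Local Open Scope classical_set_scope.
Local Open Scope ring_scope.

(** * Continuity in products, quotients and subspaces *)

Lemma ptws_continuous (Z Y : topologicalType) (I : Type)
    (f : Z -> {ptws I -> Y}) :
  (forall i, continuous (fun z => f z i)) -> continuous f.
Proof.
move=> fc z; apply/cvg_sup => i.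
exact: (@continuous_comp_initial _ _ _ (fun g : I -> Y => g i) f (fc i) z).
Qed.

Lemma ptws_eval_continuous (Y : topologicalType) (I : eqType) (i : I) :
  continuous (fun f : {ptws I -> Y} => f i).
Proof. exact: (@proj_continuous I (fun=> Y) i). Qed.

Lemma continuous_comp_fun (U V W : topologicalType) (f : U -> V) (g : V -> W) :
  continuous f -> continuous g -> continuous (g \o f).
Proof. by move=> fc gc u; apply: continuous_comp; [exact: fc|exact: gc]. Qed.

Lemma pair_continuous (U V W : topologicalType) (f : U -> V) (g : U -> W) :
  continuous f -> continuous g -> continuous (fun u => (f u, g u)).
Proof. by move=> fc gc u; apply: cvg_pair; [exact: fc|exact: gc]. Qed.

Lemma max_continuous (R : realType) (U : topologicalType) (f g : U -> R) :
  continuous f -> continuous g -> continuous (fun u => Num.max (f u) (g u)).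
Proof. by move=> fc gc u; exact: (continuous_max (fc u) (gc u)). Qed.

Lemma glue_continuous (R : realType) (T Y : topologicalType) (s : T -> R)
    (f g : T -> Y) (c : R) :
  continuous s -> continuous f -> continuous g ->
  (forall x, s x = c -> f x = g x) ->
  continuous (fun x => if s x <= c then f x else g x).
Proof.
move=> sc fc gc fg; apply/continuous_subspace_setT.
have -> : [set: T] = s @^-1` [set y | y <= c] `|` s @^-1` [set y | c <= y].
  by apply/seteqP; split => // x _ /=; case: (leP (s x) c) => [|/ltW]; [left|right].
apply: withinU_continuous.
- by apply: closed_comp => [x _|]; [exact: sc|exact: closed_le].
- by apply: closed_comp => [x _|]; [exact: sc|exact: closed_ge].
- apply: (@subspace_eq_continuous _ _ _ f); last exact: continuous_subspaceT.
  by move=> x /set_mem /= xc; rewrite /from_subspace xc.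
- apply: (@subspace_eq_continuous _ _ _ g); last exact: continuous_subspaceT.
  move=> x /set_mem /= cx; rewrite /from_subspace; case: ifP => // xc.
  by rewrite fg //; apply/eqP; rewrite eq_le cx xc.
Qed.

(** The map Q is closed, so a continuous function on K that is constant on the
fibres of Q descends to the image. This replaces explicit inverses of the
parametrizations of discs that are used below to fill spheres. *)
Lemma quotient_extension (K Z X : topologicalType) (Q : K -> Z) (h : K -> X)
    (k0 : K) :
  compact [set: K] -> hausdorff_space Z -> continuous Q -> continuous h ->
  (forall k k', Q k = Q k' -> h k = h k') ->
  exists E : Z -> X, {within range Q, continuous E} /\ forall k, E (Q k) = h k.
Proof.
move=> cK hZ Qc hc hQ.
pose inv z := xget k0 [set k | Q k = z].
have invP k : Q (inv (Q k)) = Q k by rewrite /inv; case: xgetP => [y _ //|/(_ k)[]].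
exists (h \o inv); split => [|k]; last exact/hQ/invP.
apply/continuous_closedP => C cC; apply/closed_subspaceP.
exists (Q @` (h @^-1` C)).
  apply: compact_closed => //; apply: continuous_compact.
    exact: continuous_subspaceT.
  apply: (subclosed_compact _ cK) => //.
  by apply: closed_comp => // k _; exact: hc.
apply/seteqP; split => [_ [[k Ck <-]] _|z []] /=.
  split; last by exists k.
  by rewrite /from_subspace /= (hQ _ k) //; exact: invP.
move=> Cz [k _ kz]; split; last by exists k.
by exists (inv z) => //=; rewrite -kz invP.
Qed.

Lemma injective_hausdorff (U V : topologicalType) (f : U -> V) :
  continuous f -> injective f -> hausdorff_space V -> hausdorff_space U.
Proof.
move=> fc fI hV p q pq; apply/fI/hV => A B /fc fA /fc fB.
by have [u [Au Bu]] := pq _ _ fA fB; exists (f u).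
Qed.

Lemma within_comp (U V W : topologicalType) (A : set V) (B : set U)
    (f : U -> V) (g : V -> W) :
  continuous f -> (forall u, B u -> A (f u)) -> {within A, continuous g} ->
  {within B, continuous (g \o f)}.
Proof.
move=> fc fA gc; apply/subspace_continuousP => x Bx.
have /subspace_continuousP/(_ _ (fA x Bx)) H := gc.
move=> P /H; rewrite /= !nbhs_simpl /= /within /= => /fc; rewrite nbhs_simpl /=.
by apply: filterS => u h /fA; exact: h.
Qed.

Lemma comp_within_continuous (U V W : topologicalType) (A : set V)
    (f : U -> V) (g : V -> W) :
  continuous f -> (forall u, A (f u)) -> {within A, continuous g} ->
  continuous (g \o f).
Proof.
by move=> fc fA gc; apply/continuous_subspace_setT; apply: within_comp gc.
Qed.

Lemma sub_cst_continuous (R : realType) (U : topologicalType) (f : U -> R) (c : R) :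
  continuous f -> continuous (fun u => f u - c).
Proof. by move=> fc u; apply: cvgB; [exact: fc|exact: cvg_cst]. Qed.

Lemma linear_continuous (R : realType) (T : topologicalType) (u : T -> R) (c : R) :
  continuous u -> continuous (fun t => u t * c).
Proof. by move=> uc t; apply: cvgM; [exact: uc|exact: cvg_cst]. Qed.

Lemma add_continuous (R : realType) (T : topologicalType) (u v : T -> R) :
  continuous u -> continuous v -> continuous (fun t => u t + v t).
Proof. by move=> uc vc t; apply: cvgD; [exact: uc|exact: vc]. Qed.

Lemma mul_continuous (R : realType) (T : topologicalType) (u v : T -> R) :
  continuous u -> continuous v -> continuous (fun t => u t * v t).
Proof. by move=> uc vc t; apply: cvgM; [exact: uc|exact: vc]. Qed.

Lemma fst_continuous (U V : topologicalType) : continuous (fun st : U * V => st.1).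
Proof. by move=> st; exact: cvg_fst. Qed.

Lemma snd_continuous (U V : topologicalType) : continuous (fun st : U * V => st.2).
Proof. by move=> st; exact: cvg_snd. Qed.

Section UnitInterval.
Variable R : realType.

Lemma set_val_continuous : continuous (set_val : unitI R -> R).
Proof. exact: initial_continuous. Qed.

Lemma clampE (x : R) : set_val (clamp x) = Num.max 0 (Num.min x 1).
Proof. by []. Qed.

Lemma set_val_itv (t : unitI R) : 0 <= set_val t <= 1.
Proof. by have /= := set_valP t; rewrite in_itv. Qed.

Lemma set_valK (t : unitI R) : clamp (set_val t) = t.
Proof.
apply: val_inj => /=; have := set_val_itv t; rewrite set_valE /= => /andP[t0 t1].
by rewrite min_l // max_r.
Qed.

Lemma clamp_continuous : continuous (@clamp R).
Proof.
apply: continuous_comp_initial => x /=.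
have -> : set_val \o @clamp R = (fun x : R => Num.max 0 (Num.min x 1)) by [].
apply: (@continuous_comp _ _ _ (fun x : R => Num.min x 1) (fun y => Num.max 0 y)).
  by apply: continuous_min => //; exact: cst_continuous.
by apply: continuous_max => //; exact: cst_continuous.
Qed.

Lemma set_val0 : set_val (clamp 0 : unitI R) = 0.
Proof. by rewrite clampK // lexx ler01. Qed.

Lemma set_val1 : set_val (clamp 1 : unitI R) = 1.
Proof. by rewrite clampK // lexx ler01. Qed.

Definition unit_clamp (x : R) : R := set_val (clamp x).

Lemma unit_clampK x : 0 <= x <= 1 -> unit_clamp x = x.
Proof. exact: clampK. Qed.

Lemma unit_clamp_le0 x : x <= 0 -> unit_clamp x = 0.
Proof.
by move=> x0'; rewrite /unit_clamp clampE max_l // ge_min x0'.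
Qed.

Lemma unit_clamp_ge1 x : 1 <= x -> unit_clamp x = 1.
Proof.
by move=> x1; rewrite /unit_clamp clampE min_r // max_r // ler01.
Qed.

Lemma unit_clamp_continuous : continuous unit_clamp.
Proof.
by apply: continuous_comp_fun; [exact: clamp_continuous|exact: set_val_continuous].
Qed.

Lemma affine_continuous (a b : R) : continuous (fun t : R => a * t + b).
Proof.
move=> t; apply: cvgD; last exact: cvg_cst.
by apply: cvgM; [exact: cvg_cst|exact: cvg_id].
Qed.

Lemma unitI_compact : compact [set: unitI R].
Proof.
have -> : [set: unitI R] = @clamp R @` `[0, 1]%classic.
  apply/seteqP; split => // t _; exists (set_val t); last exact: set_valK.
  by rewrite /= in_itv /=; exact: set_val_itv.
apply: continuous_compact; last exact: segment_compact.
apply: continuous_subspaceT; exact: clamp_continuous.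
Qed.

Lemma ptws_unitI_compact (I : eqType) : compact [set: {ptws I -> unitI R}].
Proof.
have := @tychonoff I (fun=> unitI R) (fun=> setT) (fun=> unitI_compact).
by congr compact; apply/seteqP; split.
Qed.

Lemma unitI_hausdorff : hausdorff_space (unitI R).
Proof. exact: (injective_hausdorff set_val_continuous val_inj (@Rhausdorff R)). Qed.

Lemma ptws_hausdorff (I : eqType) : hausdorff_space {ptws I -> R}.
Proof. exact: (@hausdorff_product I (fun=> R) (fun=> @Rhausdorff R)). Qed.

(** The boxes around x generate a filter that converges to x coordinatewise, hence
in the product topology. *)
Lemma box_nbhs (I : finType) (x : {ptws I -> R}) (A : set {ptws I -> R}) :
  nbhs x A ->
  exists2 e : R, 0 < e & forall y : {ptws I -> R},
    (forall i, `|y i - x i| < e) -> A y.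
Proof.
pose F : set_system {ptws I -> R} := filter_from [set e : R | 0 < e]
  (fun e => [set y : {ptws I -> R} | forall i, `|y i - x i| < e]).
have FF : Filter F.
  apply: filter_from_filter; first by exists 1 => /=.
  move=> a b /= a0 b0; exists (Num.min a b) => /=; first by rewrite lt_min a0.
  by move=> y yab; split => i; have := yab i; rewrite lt_min => /andP[].
suff Fx : F --> x by move=> /Fx [e e0 eA]; exists e.
apply/cvg_sup => i A' [_ [[B oB <-] Bx BA]].
have : nbhs (x i) B by exact: open_nbhs_nbhs.
move=> /nbhs_ballP [e /= e0 eB]; exists e => // y ye; apply: BA => /=.
by apply: eB; rewrite /ball /= distrC; exact: ye.
Qed.
End UnitInterval.

(** * Loops carried by maps of the plane *)

(** Here and below, [phi] stands for the isomorphism from the fundamental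
group. *)
Section Loops.
Variables (R : realType) (X : topologicalType) (x0 : X) (G : groupType).
Variable phi : (unitI R -> X) -> G.
Hypothesis phi_homotopic : forall f g, is_loop x0 f -> is_loop x0 g ->
  (phi f = phi g <-> homotopic_rel R [set clamp 0; clamp 1] f g).
Hypothesis phi_concat : forall f g, is_loop x0 f -> is_loop x0 g ->
  phi (loop_concat f g) = (phi f * phi g)%g.

(** Loops are described by functions on the whole line, which can be combined
with affine formulas without proofs that parameters lie in the unit interval. *)
Definition real_loop (c : R -> X) : unitI R -> X := fun t => c (set_val t).

Lemma is_real_loop (c : R -> X) :
  continuous c -> c 0 = x0 -> c 1 = x0 -> is_loop x0 (real_loop c).
Proof.
move=> cc c0 c1; split; rewrite /real_loop ?set_val0 ?set_val1 //.
by apply: continuous_comp_fun => //; exact: set_val_continuous.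
Qed.

(** The straight-line homotopy in the plane. All the homotopies between loops
that are needed below are instances of it. *)
Lemma plane_paths_homotopic (K : R * R -> X) (p q : R -> R * R) :
  continuous K -> continuous p -> continuous q ->
  p 0 = q 0 -> p 1 = q 1 -> K (p 0) = x0 -> K (p 1) = x0 ->
  phi (real_loop (K \o p)) = phi (real_loop (K \o q)).
Proof.
move=> Kc pc qc pq0 pq1 K0 K1.
have lp : is_loop x0 (real_loop (K \o p)).
  by apply: is_real_loop => //; exact: continuous_comp_fun.
have lq : is_loop x0 (real_loop (K \o q)).
  by apply: is_real_loop; rewrite /= -?pq0 -?pq1 //; exact: continuous_comp_fun.
apply/phi_homotopic => //.
exists (fun st => K (p (set_val st.2) +
  set_val st.1 *: (q (set_val st.2) - p (set_val st.2)))); split.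
- apply: (continuous_comp_fun (g := K)) => //.
  have c1 : continuous (fun st : unitI R * unitI R => set_val st.1 : R).
    apply: (continuous_comp_fun (f := fst)); first by move=> ?; exact: cvg_fst.
    exact: set_val_continuous.
  have c2 : continuous (fun st : unitI R * unitI R => set_val st.2 : R).
    apply: (continuous_comp_fun (f := snd)); first by move=> ?; exact: cvg_snd.
    exact: set_val_continuous.
  have c3 := continuous_comp_fun c2 pc; have c4 := continuous_comp_fun c2 qc.
  move=> x; apply: cvgD; first exact: c3.
  by apply: cvgZ; [exact: c1|apply: cvgB; [exact: c4|exact: c3]].
- by move=> y; rewrite set_val0 scale0r addr0.
- by move=> y; rewrite set_val1 scale1r addrC subrK.
- by move=> t y [->|->]; rewrite /real_loop /= ?set_val0 ?set_val1 ?pq0 ?pq1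
    subrr scaler0 addr0.
Qed.

(** The path from (0, 0) to (0, 1) and then to (1, 1). *)
Definition hook (t : R) : R * R := (unit_clamp (2 * t - 1), unit_clamp (2 * t)).

Lemma hook_continuous : continuous hook.
Proof.
have h c := continuous_comp_fun (@affine_continuous R 2 c) (@unit_clamp_continuous R).
apply: pair_continuous; first exact: h.
by under eq_fun do rewrite -[2 * _]addr0; exact: h.
Qed.

Lemma concat_hook (K : R * R -> X) :
  loop_concat (real_loop (fun t => K (0, t))) (real_loop (fun t => K (t, 1))) =
  real_loop (K \o hook).
Proof.
apply/funext => t; rewrite /loop_concat /real_loop /= /hook.
have /andP[t0 t1] := set_val_itv t.
case: ifP => [t2|/negbT]; last rewrite -ltNge => t2.
  by rewrite [unit_clamp (_ - 1)]unit_clamp_le0 //; lra.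
by rewrite [unit_clamp (2 * _)]unit_clamp_ge1 //; lra.
Qed.

Lemma concat_loop (f g : unitI R -> X) :
  is_loop x0 f -> is_loop x0 g -> is_loop x0 (loop_concat f g).
Proof.
move=> [fc f0 f1] [gc g0 g1]; split.
- have dbl c : continuous (fun t : unitI R => clamp (2 * set_val t + c)).
    have := continuous_comp_fun (@affine_continuous R 2 c) (@clamp_continuous R).
    exact: (continuous_comp_fun (@set_val_continuous R)).
  apply: (glue_continuous (s := set_val)
    (f := fun t : unitI R => f (clamp (2 * set_val t)))).
  + exact: set_val_continuous.
  + have -> : (fun t : unitI R => f (clamp (2 * set_val t))) =
              (fun t : unitI R => f (clamp (2 * set_val t + 0))).
      by apply/funext => t; rewrite addr0.
    exact: continuous_comp_fun (dbl 0) fc.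
  + exact: continuous_comp_fun (dbl (- 1)) gc.
  + by move=> t ->; rewrite mulfV // subrr f1 g0.
- by rewrite /loop_concat set_val0 invr_ge0 ler0n mulr0.
- rewrite /loop_concat set_val1 ifF; last by apply/negP; lra.
  by rewrite (_ : 2 * 1 - 1 = 1) //; lra.
Qed.

Lemma diagonal_rule (K : R * R -> X) :
  continuous K -> K (0, 0) = x0 -> K (0, 1) = x0 -> K (1, 1) = x0 ->
  (phi (real_loop (fun t => K (0%R, t))) *
   phi (real_loop (fun t => K (t, 1%R))))%g =
  phi (real_loop (fun t => K (t, t))).
Proof.
move=> Kc K00 K01 K11.
have c0 : continuous (fun t : R => K (0, t)).
  apply: (continuous_comp_fun (f := fun t : R => (0 : R, t)) (g := K)) => //.
  by apply: pair_continuous => t; [exact: cvg_cst|exact: cvg_id].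
have c1 : continuous (fun t : R => K (t, 1)).
  apply: (continuous_comp_fun (f := fun t : R => (t, 1 : R)) (g := K)) => //.
  by apply: pair_continuous => t; [exact: cvg_id|exact: cvg_cst].
rewrite -phi_concat; [|exact: is_real_loop..].
rewrite concat_hook.
have h0 : hook 0 = (0, 0).
  by rewrite /hook !unit_clamp_le0 //; lra.
have h1 : hook 1 = (1, 1).
  by rewrite /hook !unit_clamp_ge1 //; lra.
apply: (@plane_paths_homotopic K hook (fun t => (t, t))); rewrite ?h0 ?h1 //.
- exact: hook_continuous.
- by apply: pair_continuous => t; exact: cvg_id.
Qed.

Lemma square_rule (K : R * R -> X) :
  continuous K -> K (0, 0) = x0 -> K (0, 1) = x0 -> K (1, 0) = x0 ->
  K (1, 1) = x0 ->
  (phi (real_loop (fun t => K (0%R, t))) *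
   phi (real_loop (fun t => K (t, 1%R))))%g =
  (phi (real_loop (fun t => K (t, 0%R))) *
   phi (real_loop (fun t => K (1%R, t))))%g.
Proof.
move=> Kc K00 K01 K10 K11; rewrite diagonal_rule //.
have sc : continuous (fun st : R * R => (st.2, st.1)).
  by apply: pair_continuous => x; [exact: cvg_snd|exact: cvg_fst].
have := @diagonal_rule (fun st => K (st.2, st.1)).
by move=> ->//; exact: continuous_comp_fun sc Kc.
Qed.

End Loops.

(** * Filling spheres *)
Section SupNorm.
Variables (R : realType) (I : finType).
Implicit Types z : I -> R.

Definition sup_norm z : R := \big[Num.max/0]_i `|z i|.

Lemma sup_norm_ge0 z : 0 <= sup_norm z.
Proof. by rewrite /sup_norm; elim/big_ind: _ => // a b a0 b0; rewrite le_max a0. Qed.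

Lemma sup_norm_ge z i : `|z i| <= sup_norm z.
Proof. exact: le_bigmax_cond. Qed.

Lemma sup_norm_le z c : 0 <= c -> (forall i, `|z i| <= c) -> sup_norm z <= c.
Proof. by move=> c0 zc; apply: bigmax_le. Qed.

Lemma sup_norm_attained z : sup_norm z = 0 \/ exists i, sup_norm z = `|z i|.
Proof.
rewrite /sup_norm; elim/big_ind: _ => [|a b Ha Hb|i _]; [by left| |by right; exists i].
by rewrite /Num.max; case: ifP.
Qed.

Lemma sup_norm_eq0 z i : sup_norm z = 0 -> z i = 0.
Proof.
by move=> z0; apply/eqP; rewrite -normr_le0 -z0 sup_norm_ge.
Qed.

Lemma sup_normZ a z : sup_norm (fun i => a * z i) = `|a| * sup_norm z.
Proof.
apply/eqP; rewrite eq_le; apply/andP; split.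
  apply: sup_norm_le => [|i]; first by rewrite mulr_ge0 // sup_norm_ge0.
  by rewrite normrM ler_wpM2l // sup_norm_ge.
have [->|[i ->]] := sup_norm_attained z; first by rewrite mulr0 sup_norm_ge0.
by rewrite -normrM; apply: (sup_norm_ge (fun i => a * z i)).
Qed.

Lemma sup_norm_continuous (T : topologicalType) (z : T -> I -> R) :
  (forall i, continuous (fun t => z t i)) -> continuous (fun t => sup_norm (z t)).
Proof.
move=> zc; rewrite /sup_norm; elim: (index_enum I) => [|i r IH].
  by under [X in continuous X]eq_fun do rewrite big_nil; exact: cst_continuous.
under [X in continuous X]eq_fun do rewrite big_cons.
by apply: max_continuous => // t; apply: cvg_norm; exact: zc.
Qed.

End SupNorm.

Section Box.
Variables (R : realType) (I : Type).

Definition box : set {ptws I -> R} := [set x | forall i, 0 <= x i <= 1].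

Definition box_bd : set {ptws I -> R} :=
  [set x | box x /\ exists i, x i = 0 \/ x i = 1].

End Box.

(** The cube [0,1]^n is wrapped around the boundary of [0,1]^(n + 1), its own
boundary being collapsed to the vertex (1, ..., 1). In centred coordinates z on
the n-cube, with r the sup norm of z, the wrapping is the radial projection of
((1 - r) z, 0) + (r - 1/2) (1, ..., 1) ([wrap0]): the centre is sent to the
direction of (0, ..., 0), and each ray from the origin other than that of
(1, ..., 1) is met once. A null homotopy of a map of the n-cube then
becomes a map on the cone over the boundary of the (n + 1)-cube, that is, on the
(n + 1)-cube itself. *)
Section SphereFilling.
Variables (R : realType) (X : topologicalType) (x0 : X) (n : nat).
Notation cubeN := (cube R n).
Notation box := (@box R 'I_n.+1).
Notation box_bd := (@box_bd R 'I_n.+1).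

Definition centred (y : cubeN) (i : 'I_n) : R := 2 * set_val (y i) - 1.
Definition radius (y : cubeN) : R := sup_norm (centred y).
Definition extend0 (z : 'I_n -> R) (i : 'I_n.+1) : R :=
  oapp z 0 (unlift ord_max i).
Definition wrap0 (y : cubeN) (i : 'I_n.+1) : R :=
  (1 - radius y) * extend0 (centred y) i + (radius y - 2^-1).

Lemma extend0_max z : extend0 z ord_max = 0.
Proof. by rewrite /extend0 unlift_none. Qed.

Lemma extend0_lift z j : extend0 z (lift ord_max j) = z j.
Proof. by rewrite /extend0 liftK. Qed.

Lemma radius_le1 y : radius y <= 1.
Proof.
apply: sup_norm_le => // i; rewrite /centred; have := set_val_itv (y i).
by rewrite ler_norml; lra.
Qed.

Lemma sup_extend0 z : sup_norm (extend0 z) = sup_norm z.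
Proof.
apply/eqP; rewrite eq_le; apply/andP; split; apply: sup_norm_le => [|i];
  rewrite ?sup_norm_ge0 //.
  case: (unliftP ord_max i) => [j|] ->; rewrite ?extend0_lift ?extend0_max.
    exact: sup_norm_ge.
  by rewrite normr0 sup_norm_ge0.
by rewrite -[z i]extend0_lift sup_norm_ge.
Qed.

Lemma wrap0_neq0 y : 0 < sup_norm (wrap0 y).
Proof.
rewrite lt_neqAle sup_norm_ge0 andbT; apply/eqP => /esym w0.
have e1 : radius y = 2^-1.
  have := sup_norm_eq0 ord_max w0; rewrite /wrap0 extend0_max mulr0 add0r.
  by move/eqP; rewrite subr_eq0 => /eqP.
have : radius y = 0.
  rewrite /radius; have [//|[i ->]] := sup_norm_attained (centred y).
  have := sup_norm_eq0 (lift ord_max i) w0; rewrite /wrap0 extend0_lift e1.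
  by move=> h; have -> : centred y i = 0; [lra|rewrite normr0].
rewrite e1; lra.
Qed.

(** The time of the homotopy is the radial coordinate: time 0 is the boundary of
the cube and time 1 its centre. *)
Definition wrap (ty : unitI R * cubeN) : {ptws 'I_n.+1 -> R} := fun i =>
  2^-1 + (1 - set_val ty.1) * (wrap0 ty.2 i / (2 * sup_norm (wrap0 ty.2))).

Lemma sup_wrap t y :
  sup_norm (fun i => wrap (t, y) i - 2^-1) = (1 - set_val t) / 2.
Proof.
have -> : (fun i => wrap (t, y) i - 2^-1) =
    (fun i => ((1 - set_val t) / (2 * sup_norm (wrap0 y))) * wrap0 y i).
  by apply/funext => i; rewrite /wrap /= addrAC subrr add0r mulrA mulrAC.
have w0 := wrap0_neq0 y; have /andP[t0 t1] := set_val_itv t.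
rewrite sup_normZ ger0_norm.
  by rewrite invfM mulrA mulfVK // gt_eqF.
by rewrite divr_ge0 ?subr_ge0 // mulr_ge0 // ltW.
Qed.

Lemma wrap_continuous : continuous wrap.
Proof.
have c1 : continuous (fun ty : unitI R * cubeN => set_val ty.1 : R).
  apply: (continuous_comp_fun (f := fst)); first by move=> ?; exact: cvg_fst.
  exact: set_val_continuous.
have c2 i : continuous (fun ty : unitI R * cubeN => centred ty.2 i).
  move=> ty; apply: cvgB; last exact: cvg_cst.
  apply: cvgM; first exact: cvg_cst.
  move: ty; apply: (continuous_comp_fun (f := fun ty : unitI R * cubeN => ty.2 i)).
    apply: (continuous_comp_fun (f := snd) (g := fun y : cubeN => y i)).
      by move=> ?; exact: cvg_snd.
    exact: ptws_eval_continuous.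
  exact: set_val_continuous.
have c3 : continuous (fun ty : unitI R * cubeN => radius ty.2).
  exact: sup_norm_continuous.
have c4 i : continuous (fun ty : unitI R * cubeN => wrap0 ty.2 i).
  move=> ty; apply: cvgD; last by apply: cvgB; [exact: c3|exact: cvg_cst].
  apply: cvgM; first by apply: cvgB; [exact: cvg_cst|exact: c3].
  rewrite /extend0; case: unliftP => [j _|_] /=; [exact: c2|exact: cvg_cst].
apply: ptws_continuous => i ty.
apply: cvgD; first exact: cvg_cst.
apply: cvgM; first by apply: cvgB; [exact: cvg_cst|exact: c1].
apply: cvgM; first exact: c4.
apply: cvgV; first by rewrite mulf_neq0 // gt_eqF // wrap0_neq0.
by apply: cvgM; [exact: cvg_cst|exact: (sup_norm_continuous c4)].
Qed.

Lemma radius1_bd y : radius y = 1 -> cube_bd y.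
Proof.
move=> r1; have [r0|[i]] := sup_norm_attained (centred y).
  by move: r1; rewrite /radius r0 => /eqP; rewrite eq_sym oner_eq0.
rewrite -[sup_norm _]/(radius y) r1 /centred => e; exists i.
have [v0|v0] := lerP 0 (2 * set_val (y i) - 1).
  rewrite ger0_norm // in e; right; rewrite -[y i]set_valK; congr clamp; lra.
rewrite ltr0_norm // in e; left; rewrite -[y i]set_valK; congr clamp; lra.
Qed.

Lemma bd_radius1 y : cube_bd y -> radius y = 1.
Proof.
case=> i yi; apply/eqP; rewrite eq_le radius_le1 /=.
apply: le_trans (sup_norm_ge (centred y) i); rewrite /centred.
case: yi => ->; rewrite ?clampK ?lexx ?ler01 // ?mulr0 ?mulr1.
  by rewrite sub0r normrN1.
by rewrite (_ : 2 - 1 = 1) ?normr1 //; lra.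
Qed.

Lemma wrap_bd_const y : radius y = 1 -> wrap (clamp 0, y) = fun=> 1.
Proof.
move=> r1; have w : wrap0 y = fun=> 2^-1.
  by apply/funext => i; rewrite /wrap0 r1; lra.
have s : sup_norm (wrap0 y) = 2^-1.
  apply/eqP; rewrite eq_le; apply/andP; split.
    by apply: sup_norm_le => [|i]; rewrite ?w ?ger0_norm ?invr_ge0.
  by have := sup_norm_ge (wrap0 y) ord0; rewrite {1}w ger0_norm ?invr_ge0.
apply/funext => i; rewrite /wrap s w /= clampK ?lexx ?ler01 //.
by field.
Qed.

(** Let r be the radius of y and b = r - 1/2, and likewise r', b' for y'. The last
coordinates give b = l b', and the sup norms of the remaining parts give
(1 - r) r = l (1 - r') r', where (1 - r) r = 1/4 - b^2. Both together force
(1 - l) (1/4 + l b'^2) = 0, hence l = 1. *)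
Lemma wrap0_ray y y' l : 0 < l -> (forall i, wrap0 y i = l * wrap0 y' i) ->
  y = y' \/ radius y = 1 /\ radius y' = 1.
Proof.
move=> l0 e; set a := radius y; set a' := radius y'.
have e1 : a - 2^-1 = l * (a' - 2^-1).
  by have := e ord_max; rewrite /wrap0 !extend0_max !mulr0 !add0r.
have e2 i : (1 - a) * extend0 (centred y) i = l * (1 - a') * extend0 (centred y') i.
  by have := e i; rewrite /wrap0 -/a -/a' mulrDr -e1 mulrA => /addIr.
have a1 : 0 <= 1 - a by rewrite subr_ge0 radius_le1.
have a1' : 0 <= 1 - a' by rewrite subr_ge0 radius_le1.
have e3 : (1 - a) * a = l * (1 - a') * a'.
  have l1 : 0 <= l * (1 - a') by rewrite mulr_ge0 // ltW.
  have /(congr1 (@sup_norm _ _)) : (fun i => (1 - a) * extend0 (centred y) i) =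
      (fun i => l * (1 - a') * extend0 (centred y') i) by exact/funext.
  by rewrite !sup_normZ !sup_extend0 (ger0_norm a1) (ger0_norm l1).
have l1 : l = 1.
  have : (1 - l) * (4^-1 + l * (a' - 2^-1) ^+ 2) = 0.
    have -> : (1 - l) * (4^-1 + l * (a' - 2^-1) ^+ 2) =
        ((1 - a) * a - l * (1 - a') * a') +
         ((a - 2^-1) ^+ 2 - (l * (a' - 2^-1)) ^+ 2) by field.
    by rewrite e3 e1; ring.
  move/eqP; rewrite mulf_eq0 => /orP[|/eqP h]; first by rewrite subr_eq0 => /eqP.
  have := mulr_ge0 (ltW l0) (sqr_ge0 (a' - 2^-1)); lra.
have aa : a = a' by move: e1; rewrite l1 mul1r => /addIr.
have [|a_neq1] := eqVneq a 1; first by right; rewrite -aa.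
left; apply/funext => j; rewrite -[y j]set_valK -[y' j]set_valK; congr clamp.
have := e2 (lift ord_max j); rewrite !extend0_lift l1 mul1r -aa.
have a10 : 1 - a != 0 by rewrite subr_eq0 eq_sym.
by move=> /(mulfI a10); rewrite /centred; lra.
Qed.

Lemma wrap_fibre t y t' y' : wrap (t, y) = wrap (t', y') ->
  t = t' /\ (t = clamp 1 \/ y = y' \/ radius y = 1 /\ radius y' = 1).
Proof.
move=> e.
have tt : t = t'.
  rewrite -[t]set_valK -[t']set_valK; congr clamp.
  by have := sup_wrap t y; rewrite e sup_wrap; lra.
split=> //; rewrite -{}tt in e *.
have [t1|t1] := eqVneq (set_val t) 1; first by left; rewrite -[t]set_valK t1.
right; have w := wrap0_neq0 y; have w' := wrap0_neq0 y'.
apply: (@wrap0_ray _ _ (sup_norm (wrap0 y) / sup_norm (wrap0 y'))).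
  by rewrite divr_gt0.
move=> i; have := congr1 (fun f => f i) e; rewrite /wrap /= => /addrI.
have t10 : 1 - set_val t != 0 by rewrite subr_eq0 eq_sym.
move=> /(mulfI t10) h; have {}h : wrap0 y i / sup_norm (wrap0 y) = wrap0 y' i / sup_norm (wrap0 y').
  move: h; rewrite !invfM; lra.
by rewrite mulrAC -mulrA -h mulrCA divff ?mulr1 // gt_eqF.
Qed.

(** On the ray of u, with last coordinate a, let Z be the sup norm of the
differences of the coordinates of u with a. The scaling factor l must satisfy
l Z = 1/4 - (l a)^2; its positive solution is 1 / (2 (Z + sqrt (Z^2 + a^2))). *)
Lemma wrap0_surj (u : 'I_n.+1 -> R) : (0 < n)%N -> sup_norm u != 0 ->
  exists y l, 0 < l /\ forall i, wrap0 y i = l * u i.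
Proof.
move=> n0 u0; pose a := u ord_max; pose z j := u (lift ord_max j) - a.
pose Z := sup_norm z; pose s := Num.sqrt (Z ^+ 2 + a ^+ 2).
have Z0 : 0 <= Z by exact: sup_norm_ge0.
have uE i : u i = extend0 z i + a.
  by case: (unliftP ord_max i) => [j|] ->;
    rewrite ?extend0_lift ?extend0_max ?subrK ?add0r.
have s2 : s ^+ 2 = Z ^+ 2 + a ^+ 2 by rewrite sqr_sqrtr // addr_ge0 // sqr_ge0.
have s0 : 0 <= s by exact: sqrtr_ge0.
have Zs0 : 0 < Z + s.
  rewrite lt_neqAle addr_ge0 // andbT; apply/eqP => Zs.
  have Z00 : Z = 0 by lra.
  have s00 : s = 0 by lra.
  have a0 : a = 0.
    by apply/eqP; rewrite -sqrf_eq0; move: s2; rewrite s00 Z00 expr0n /= add0r => <-.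
  move/eqP: u0; apply; apply/eqP; rewrite eq_le sup_norm_ge0 andbT.
  apply: sup_norm_le => // i; rewrite uE a0 addr0.
  by rewrite -[0 in X in _ <= X]Z00 /Z -sup_extend0 sup_norm_ge.
pose l := 2^-1 / (Z + s).
have l0 : 0 < l by rewrite divr_gt0 // invr_gt0.
have lZs : l * (Z + s) = 2^-1 by rewrite mulfVK // gt_eqF.
have quad : (l * a) ^+ 2 + l * Z = 4^-1.
  have -> : (l * a) ^+ 2 = l ^+ 2 * (s ^+ 2 - Z ^+ 2) by rewrite s2; ring.
  have -> : l ^+ 2 * (s ^+ 2 - Z ^+ 2) = (l * (Z + s)) * (l * (Z + s) - 2 * (l * Z)) by ring.
  by rewrite lZs; field.
have lZ0 : 0 <= l * Z by rewrite mulr_ge0 // ltW.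
pose r := l * a + 2^-1.
have ra : - 2^-1 <= l * a <= 2^-1.
  rewrite -ler_norml -(@ler_pXn2r _ 2) ?nnegrE ?invr_ge0 ?normr_ge0 //.
  rewrite real_normK ?num_real //; have -> : (2^-1 : R) ^+ 2 = 4^-1 by field.
  by rewrite -quad lerDl.
have zero_in j : `|z j| <= Z by exact: sup_norm_ge.
have [r1|r1] := eqVneq r 1.
  have Z00 : Z = 0.
    have la : l * a = 2^-1 by move: r1; rewrite /r; lra.
    have : l * Z = 0 by move: quad; rewrite la; lra.
    by move/eqP; rewrite mulf_eq0 (gt_eqF l0) /= => /eqP.
  pose y : cubeN := fun=> clamp 1; exists y, l; split => // i.
  have ry : radius y = 1.
    by apply: bd_radius1; exists (Ordinal n0); right.
  rewrite /wrap0 ry subrr mul0r add0r uE.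
  have := sup_norm_ge (extend0 z) i; rewrite sup_extend0 -/Z Z00 normr_le0 => /eqP ->.
  by move: r1; rewrite /r; lra.
have r1' : 0 < 1 - r by rewrite lt_neqAle eq_sym subr_eq0 eq_sym r1 /= /r; lra.
have rE : l * Z / (1 - r) = r.
  have -> : l * Z = r * (1 - r).
    by apply: (addrI ((l * a) ^+ 2)); rewrite quad /r; field.
  by rewrite mulfK // gt_eqF.
pose y : cubeN := fun j => clamp ((l * z j / (1 - r) + 1) / 2).
have yE j : centred y j = (l / (1 - r)) * z j.
  rewrite /centred /y clampK; first by field; rewrite gt_eqF.
  have : `|l * z j / (1 - r)| <= 1.
    have i0 : 0 < (1 - r)^-1 by rewrite invr_gt0.
    rewrite normrM normrM (gtr0_norm l0) (gtr0_norm i0).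
    apply: (@le_trans _ _ (l * Z / (1 - r))).
      by rewrite (ler_pM2r i0) (ler_pM2l l0).
    by rewrite rE /r; lra.
  by rewrite ler_norml; lra.
have ry : radius y = r.
  rewrite /radius (_ : centred y = fun j => (l / (1 - r)) * z j); last exact/funext.
  have i0 : 0 < l / (1 - r) by rewrite divr_gt0.
  by rewrite sup_normZ (gtr0_norm i0) -/Z mulrAC.
exists y, l; split => // i.
rewrite /wrap0 ry uE.
case: (unliftP ord_max i) => [j|] ->; rewrite ?extend0_lift ?extend0_max.
  by rewrite yE mulrA mulrCA divff ?gt_eqF // /r; ring.
by rewrite /r; ring.
Qed.

Lemma wrap_surj x : (0 < n)%N -> box x ->
  exists y, wrap (clamp (1 - sup_norm (fun i => 2 * x i - 1)), y) = x.
Proof.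
move=> n0 bx; set u := fun i => 2 * x i - 1.
have u1 : sup_norm u <= 1.
  by apply: sup_norm_le => // i; have := bx i; rewrite ler_norml /u; lra.
have u0 := sup_norm_ge0 u.
have cu : 0 <= 1 - sup_norm u <= 1 by lra.
have [u00|/(wrap0_surj n0) [y [l [l0 wl]]]] := eqVneq (sup_norm u) 0.
  exists (fun=> clamp 1); apply/funext => i; rewrite /wrap /= clampK // u00.
  by have := sup_norm_eq0 i u00; rewrite /u; lra.
exists y; apply/funext => i; rewrite /wrap /= clampK //.
have -> : sup_norm (wrap0 y) = l * sup_norm u.
  by rewrite (_ : wrap0 y = fun i => l * u i) ?sup_normZ ?gtr0_norm //; exact/funext.
have su : sup_norm u != 0.
  have := wrap0_neq0 y.
  rewrite (_ : wrap0 y = fun i => l * u i) ?sup_normZ ?gtr0_norm //; last exact/funext.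
  by rewrite pmulr_rgt0 // => /gt_eqF ->.
rewrite wl {2}/u; field.
by rewrite su gt_eqF.
Qed.

(** The values of [f] on the boundary form a map of the n-cube that is constant on
its boundary. Its null homotopy is constant on the fibres of [wrap] and
descends to the cube. *)
Lemma sphere_filling (f : {ptws 'I_n.+1 -> R} -> X) : (0 < n)%N ->
  pi_trivial R x0 n -> {within box_bd, continuous f} -> f (fun=> 1) = x0 ->
  exists E : {ptws 'I_n.+1 -> R} -> X,
    {within box, continuous E} /\ forall x, box_bd x -> E x = f x.
Proof.
move=> n0 pi0 fc f1.
pose g (y : cubeN) := f (wrap (clamp 0, y)).
have wbd y : box_bd (wrap (clamp 0, y)).
  have := sup_wrap (clamp 0) y; rewrite clampK ?lexx ?ler01 // subr0 div1r => s.
  split.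
    move=> i; have := sup_norm_ge (fun i => wrap (clamp 0, y) i - 2^-1) i.
    by rewrite s ler_norml; lra.
  have [|[i]] := sup_norm_attained (fun i => wrap (clamp 0, y) i - 2^-1).
    by rewrite s; lra.
  rewrite s => e; exists i; have [v0|v0] := lerP 0 (wrap (clamp 0, y) i - 2^-1).
    by rewrite ger0_norm // in e; right; lra.
  by rewrite ltr0_norm // in e; left; lra.
have gc : continuous g.
  apply: (@comp_within_continuous _ _ _ box_bd (fun y : cubeN => wrap (clamp 0, y)) f) => //.
  apply: (continuous_comp_fun (f := fun y : cubeN => (clamp 0 : unitI R, y))).
    by apply: pair_continuous; [exact: cst_continuous|move=> y; exact: cvg_id].
  exact: wrap_continuous.
have gbd y : cube_bd y -> g y = x0.
  by move=> /bd_radius1 r1; rewrite /g wrap_bd_const.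
have [H [Hc H0 H1 Hbd]] := pi0 g gc gbd.
have cK : compact [set: unitI R * cubeN].
  by rewrite -setXTT; apply: compact_setX;
    [exact: unitI_compact|exact: ptws_unitI_compact].
have [|E [Ec EQ]] := @quotient_extension _ _ _ wrap H (clamp 0, fun=> clamp 0)
  cK (@ptws_hausdorff R _) wrap_continuous Hc.
  move=> [t y] [t' y'] /wrap_fibre[<-] [->|[->//|[/radius1_bd b /radius1_bd b']]].
    by rewrite !H1.
  by rewrite !Hbd // !gbd.
exists E; split.
  apply: continuous_subspaceW Ec => x bx.
  by have [y <-] := wrap_surj n0 bx; exists (clamp (1 - sup_norm (fun i => 2 * x i - 1)), y).
move=> x [bx [i xi]]; have [y] := wrap_surj n0 bx.
have -> : sup_norm (fun i => 2 * x i - 1) = 1.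
  apply/eqP; rewrite eq_le; apply/andP; split.
    by apply: sup_norm_le => // j; have := bx j; rewrite ler_norml; lra.
  apply: le_trans (sup_norm_ge _ i); case: xi => ->.
    by rewrite mulr0 sub0r normrN1.
  by rewrite (_ : 2 * 1 - 1 = 1) ?normr1 //; lra.
by rewrite subrr => <-; rewrite EQ H0.
Qed.

End SphereFilling.

(** * Filling squares between commuting loops *)
Section Lens.
Variables (R : realType) (X : topologicalType) (x0 : X) (G : groupType).
Variable phi : (unitI R -> X) -> G.
Hypothesis phi_homotopic : forall f g, is_loop x0 f -> is_loop x0 g ->
  (phi f = phi g <-> homotopic_rel R [set clamp 0; clamp 1] f g).
Hypothesis phi_concat : forall f g, is_loop x0 f -> is_loop x0 g ->
  phi (loop_concat f g) = (phi f * phi g)%g.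

Lemma concat_left (a b : R -> X) (x : R) : 0 <= x <= 1 ->
  loop_concat (real_loop a) (real_loop b) (clamp (x / 2)) = a x.
Proof.
move=> x01; rewrite /loop_concat clampK; last lra.
rewrite ifT; last lra.
by rewrite /real_loop mulrC divfK // clampK.
Qed.

Lemma concat_right (a b : R -> X) (x : R) : a 1 = b 0 -> 0 <= x <= 1 ->
  loop_concat (real_loop a) (real_loop b) (clamp ((1 + x) / 2)) = b x.
Proof.
move=> ab x01; rewrite /loop_concat clampK; last lra.
rewrite /real_loop (_ : 2 * ((1 + x) / 2) = 1 + x); last by field.
case: ifP => [h|_]; last first.
  by rewrite (_ : 1 + x - 1 = x) ?clampK //; ring.
have -> : x = 0 by lra.
by rewrite addr0 clampK // ?ab // lexx ler01.
Qed.

Local Notation i0 := (ord0 : 'I_2).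
Local Notation i1 := (ord_max : 'I_2).

(** At the time [t], the segment from the path along the bottom and right edges
([s] = 0) to the path along the left and top edges ([s] = 1). It lies on the
antidiagonal where the coordinates sum to 2 t, and degenerates to a point only at
both ends. *)
Definition lens (st : unitI R * unitI R) : {ptws 'I_2 -> R} :=
  let s := set_val st.1 in let t := set_val st.2 in
  let p := unit_clamp (2 * t - 1) in let q := unit_clamp (2 * t) in
  fun i => if i == i1 then p + s * (q - p) else q + s * (p - q).

Lemma lens_width (t : R) : 0 <= t <= 1 ->
  0 <= unit_clamp (2 * t) - unit_clamp (2 * t - 1) /\
  (unit_clamp (2 * t) - unit_clamp (2 * t - 1) = 0 -> t = 0 \/ t = 1) /\
  unit_clamp (2 * t) + unit_clamp (2 * t - 1) = 2 * t.
Proof.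
move=> t01; have [t2|t2] := lerP t (2^-1).
  rewrite (@unit_clamp_le0 _ (_ - 1)); last lra.
  rewrite unit_clampK; last lra.
  by split; [lra|split => [h|]; [left|]; lra].
rewrite (@unit_clamp_ge1 _ (2 * t)); last lra.
rewrite unit_clampK; last lra.
by split; [lra|split => [h|]; [right|]; lra].
Qed.

Lemma lens_fibre s t s' t' : lens (s, t) = lens (s', t') ->
  t = t' /\ (s = s' \/ t = clamp 0 \/ t = clamp 1).
Proof.
move=> e; have := congr1 (fun f => f i0) e; have := congr1 (fun f => f i1) e.
rewrite /lens /=.
have [w [wt wsum]] := lens_width (set_val_itv t).
have [w' [wt' wsum']] := lens_width (set_val_itv t').
move=> e1 e2.
have tt : t = t'.
  rewrite -[t]set_valK -[t']set_valK; congr clamp; lra.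
split=> //; rewrite -{}tt in e1 e2 *.
have [/wt[t0|t1]|wN0] := eqVneq (unit_clamp (2 * set_val t) - unit_clamp (2 * set_val t - 1)) 0.
- by right; left; rewrite -[t]set_valK t0.
- by right; right; rewrite -[t]set_valK t1.
left; rewrite -[s]set_valK -[s']set_valK; congr clamp.
by apply: (mulIf wN0); move: e1 => /addrI.
Qed.

Lemma lens_continuous : continuous lens.
Proof.
have c1 : continuous (fun st : unitI R * unitI R => set_val st.1 : R).
  apply: (continuous_comp_fun (f := fst)); first by move=> ?; exact: cvg_fst.
  exact: set_val_continuous.
have c2 : continuous (fun st : unitI R * unitI R => set_val st.2 : R).
  apply: (continuous_comp_fun (f := snd)); first by move=> ?; exact: cvg_snd.
  exact: set_val_continuous.
have cc c : continuous (fun st : unitI R * unitI R => unit_clamp (2 * set_val st.2 + c)).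
  have h := continuous_comp_fun (@affine_continuous R 2 c) (@unit_clamp_continuous R).
  exact: continuous_comp_fun c2 h.
have c3 := cc (- 1).
have c4 : continuous (fun st : unitI R * unitI R => unit_clamp (2 * set_val st.2)).
  by under eq_fun do rewrite -[2 * _]addr0; exact: cc.
apply: ptws_continuous => i st; rewrite /lens /=; case: (i == i1).
  apply: cvgD; first exact: c3.
  by apply: cvgM; [exact: c1|apply: cvgB; [exact: c4|exact: c3]].
apply: cvgD; first exact: c4.
by apply: cvgM; [exact: c1|apply: cvgB; [exact: c3|exact: c4]].
Qed.

Lemma ord2 (i : 'I_2) : i = i0 \/ i = i1.
Proof. by case: i => -[|[|//]] h; [left|right]; apply: val_inj. Qed.

Lemma lens_surj x : box x -> exists st, lens st = x.
Proof.
move=> bx; have x0' := bx i0; have x1' := bx i1.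
pose t := (x i0 + x i1) / 2.
have t01 : 0 <= t <= 1 by rewrite /t; lra.
have [w [wt wsum]] := lens_width t01.
have p1 : unit_clamp (2 * t - 1) <= x i1 <= unit_clamp (2 * t).
  have [t2|t2] := lerP t (2^-1).
    rewrite (@unit_clamp_le0 _ (_ - 1)); last lra.
    by rewrite unit_clampK; rewrite /t in t2 *; lra.
  rewrite (@unit_clamp_ge1 _ (2 * t)); last lra.
  by rewrite unit_clampK; rewrite /t in t2 *; lra.
set p := unit_clamp (2 * t - 1) in w wt wsum p1.
set q := unit_clamp (2 * t) in w wt wsum p1.
have [w0|w0] := eqVneq (q - p) 0.
  exists (clamp 0, clamp t); apply/funext => i; rewrite /lens /= !clampK ?lexx ?ler01 //.
  by rewrite -/p -/q !mul0r !addr0; case: (ord2 i) => -> /=; rewrite /t in wsum; lra.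
have wp : 0 < q - p by rewrite lt_neqAle eq_sym w0.
exists (clamp ((x i1 - p) / (q - p)), clamp t).
apply/funext => i; rewrite /lens /= !clampK //; last first.
  by rewrite divr_ge0 //= ?ler_pdivrMr //; lra.
rewrite -/p -/q -[p - q]opprB mulrN divfK //.
by case: (ord2 i) => -> /=; rewrite /t in wsum; lra.
Qed.

(** The boundary of the square is read as the concatenations of a, b and of b, a,
which are homotopic. The homotopy is constant at both ends, where [lens]
collapses, so it descends to the square. *)
Lemma square_filling (a b : R -> X) (f : {ptws 'I_2 -> R} -> X) :
  continuous a -> continuous b ->
  a 0 = x0 -> a 1 = x0 -> b 0 = x0 -> b 1 = x0 ->
  (phi (real_loop a) * phi (real_loop b) = phi (real_loop b) * phi (real_loop a))%g ->
  (forall x, box x -> x i1 = 0 \/ x i1 = 1 -> f x = a (x i0)) ->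
  (forall x, box x -> x i0 = 0 \/ x i0 = 1 -> f x = b (x i1)) ->
  exists E : {ptws 'I_2 -> R} -> X,
    {within (@box R 'I_2), continuous E} /\ forall x, box_bd x -> E x = f x.
Proof.
move=> ac bc a0 a1 b0 b1 ab fa fb.
have la : is_loop x0 (real_loop a) by exact: is_real_loop.
have lb : is_loop x0 (real_loop b) by exact: is_real_loop.
have lab := concat_loop la lb; have lba := concat_loop lb la.
have [H [Hc H0 H1 Hbd]] : homotopic_rel R [set clamp 0; clamp 1]
    (loop_concat (real_loop a) (real_loop b)) (loop_concat (real_loop b) (real_loop a)).
  by apply/phi_homotopic => //; rewrite !phi_concat.
have cK : compact [set: unitI R * unitI R].
  by rewrite -setXTT; apply: compact_setX; exact: unitI_compact.
have [|E [Ec EQ]] := @quotient_extension _ _ _ lens H (clamp 0, clamp 0)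
  cK (@ptws_hausdorff R _) lens_continuous Hc.
  move=> [s t] [s' t'] /lens_fibre[<-] [->//|h].
  by rewrite !Hbd.
exists E; split.
  by apply: continuous_subspaceW Ec => x /lens_surj[st <-]; exists st.
have lens0 s t : (s == 0) || (s == 1) -> 0 <= t <= 1 ->
    lens (clamp s, clamp t) = fun i => if (i == i1) == (s == 0)
      then unit_clamp (2 * t - 1) else unit_clamp (2 * t).
  move=> s01 t01; apply/funext => i; rewrite /lens /= (clampK t01).
  case/orP: s01 => /eqP ->; rewrite clampK ?lexx ?ler01 // ?eqxx ?oner_eq0.
    by rewrite !mul0r !addr0; case: (i == i1).
  by rewrite !mul1r !(addrC _ (_ - _)) !subrK; case: (i == i1).
have E0 x t s : lens (clamp s, clamp t) = x -> E x = H (clamp s, clamp t).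
  by move=> <-; rewrite EQ.
move=> x [bx [i xi]]; have xb0 := bx i0; have xb1 := bx i1.
have half (y : R) : 0 <= y <= 1 -> 0 <= y / 2 <= 1 by lra.
have half' (y : R) : 0 <= y <= 1 -> 0 <= (1 + y) / 2 <= 1 by lra.
have h1 (y : R) : 2 * (y / 2) = y :> R by rewrite mulrC divfK.
have cl0 (y : R) : 0 <= y <= 1 -> unit_clamp (y - 1) = 0 :> R.
  by move=> ?; apply: unit_clamp_le0; lra.
have cl1 (y : R) : 0 <= y <= 1 -> unit_clamp (1 + y) = 1 :> R.
  by move=> ?; apply: unit_clamp_ge1; lra.
have cl2 (y : R) : 0 <= y <= 1 -> unit_clamp (1 + y - 1) = y :> R.
  by move=> ?; rewrite unit_clampK; lra.
have s0 : ((0 : R) == 0) || ((0 : R) == 1) by rewrite eqxx.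
have s1 : ((1 : R) == 0) || ((1 : R) == 1) by rewrite eqxx orbT.
case: (ord2 i) xi => -> [xi|xi].
- rewrite fb //; last by left.
  rewrite (E0 _ (x i1 / 2) 1) ?H1 ?concat_left //.
  rewrite lens0 ?half // h1 cl0 // unit_clampK // oner_eq0.
  by apply/funext => j; case: (ord2 j) => -> /=.
- rewrite fb //; last by right.
  rewrite (E0 _ ((1 + x i1) / 2) 0) ?H0 ?concat_right ?a1 ?b0 //.
  rewrite lens0 ?half' // h1 cl1 // cl2 // eqxx.
  by apply/funext => j; case: (ord2 j) => -> /=.
- rewrite fa //; last by left.
  rewrite (E0 _ (x i0 / 2) 0) ?H0 ?concat_left //.
  rewrite lens0 ?half // h1 cl0 // unit_clampK // eqxx.
  by apply/funext => j; case: (ord2 j) => -> /=.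
- rewrite fa //; last by right.
  rewrite (E0 _ ((1 + x i0) / 2) 1) ?H1 ?concat_right ?a0 ?b1 //.
  rewrite lens0 ?half' // h1 cl1 // cl2 // oner_eq0.
  by apply/funext => j; case: (ord2 j) => -> /=.
Qed.

End Lens.

(** * Extending maps over the skeleta of a torus *)

(** The torus is the cube [0,1]^I with opposite faces identified; maps on it are
functions on the cube that do not distinguish 0 and 1 in any coordinate. *)
Section Skeleta.
Variables (R : realType) (X : topologicalType) (x0 : X) (I : finType).
Local Notation RI := {ptws I -> R}.

Definition is01 (t : R) := (t == 0) || (t == 1).

(** The coordinates in which x is interior: the cell of the torus that contains
x. *)
Definition support (x : RI) : {set I} := [set i | ~~ is01 (x i)]%SET.

Definition skeleton (k : nat) : set RI := [set x | box x /\ (#|support x| <= k)%N].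

(** All the closed faces of the cube that become the closed cell of S in the
torus. *)
Definition cell (S : {set I}) : set RI :=
  [set x | box x /\ forall i, i \notin S -> is01 (x i)].

Definition torus_eq (x y : RI) : Prop :=
  forall i, x i = y i \/ (is01 (x i) /\ is01 (y i)).

Definition skeleton_map (k : nat) (G : RI -> X) : Prop :=
  [/\ {within skeleton k, continuous G},
      forall x y, torus_eq x y -> skeleton k x -> skeleton k y -> G x = G y
    & G (fun=> 0) = x0].

(** As [E] depends only on the coordinates in S, it has the same values on all the
parallel faces in [cell S]. *)
Definition cell_filling (k : nat) (G : RI -> X) (S : {set I}) (E : RI -> X) : Prop :=
  [/\ {within cell S, continuous E},
      forall x, cell S x -> skeleton k x -> E x = G x
    & forall x y, (forall i, i \in S -> x i = y i) -> E x = E y].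

Definition extend_skeleton k (G : RI -> X) (E : {set I} -> RI -> X) (x : RI) : X :=
  if `[< skeleton k x >] then G x else E (support x) x.

Lemma support_cell S x : cell S x -> support x \subset S.
Proof.
move=> [_ xS]; apply/fintype.subsetP => i; rewrite inE; apply: contraR => /xS.
by [].
Qed.

Lemma cell_support x : box x -> cell (support x) x.
Proof. by move=> bx; split => // i; rewrite inE negbK. Qed.

Lemma torus_eq_support x y : torus_eq x y -> support x = support y.
Proof.
move=> xy; apply/setP => i; rewrite !inE.
by case: (xy i) => [->//|[-> ->]].
Qed.

Lemma cell_closed S : closed (cell S).
Proof.
have -> : cell S = \bigcap_i ((fun x : RI => x i) @^-1`
    ([set t | 0 <= t] `&` ([set t | t <= 1] `&`
     (if i \in S then setT else [set t | t = 0] `|` [set t | t = 1])))).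
  apply/seteqP; split => x.
    move=> [bx xS] i _ /=; have /andP[-> ->] := bx i; split => //; split => //.
    case: ifPn => // /xS /orP[] /eqP; [by left|by right].
  move=> h; split=> i; have [/= h0 [h1 h2]] := h i Logic.I; first by rewrite h0.
  by move=> iS; move: h2; rewrite (negPf iS) /is01 => -[] /= ->; rewrite eqxx ?orbT.
apply: closed_bigI => i _; apply: closed_comp => [x _|].
  exact: ptws_eval_continuous.
apply: closedI; first exact: closed_ge.
apply: closedI; first exact: closed_le.
case: ifP => _; first exact: closedT.
by apply: closedU; exact: closed_eq.
Qed.

(** The next skeleton is a finite union of closed cells, and on each of them the
extension coincides with a function that is continuous there. *)
Lemma skeleton_step k G E : skeleton_map k G ->
  (forall S : {set I}, #|S| = k.+1 -> cell_filling k G S (E S)) ->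
  skeleton_map k.+1 (extend_skeleton k G E) /\
  forall x, skeleton k x -> extend_skeleton k G E x = G x.
Proof.
move=> [Gc Gper G0] EF; set G' := extend_skeleton k G E.
have G'G x : skeleton k x -> G' x = G x.
  by move=> kx; rewrite /G' /extend_skeleton; case: asboolP.
split=> //; split; last by rewrite G'G //; split => [i|]; rewrite ?lexx ?ler01 //
  (_ : support _ = finset.set0) ?cards0 //; apply/setP => i; rewrite !inE /is01 eqxx.
  pose good (A : set RI) := closed A /\ {within A, continuous G'}.
  suff [_ H] : good (\big[setU/set0]_(S : {set I} | (#|S| <= k.+1)%N) cell S).
    apply: continuous_subspaceW H => x [bx xk].
    by rewrite (bigD1 (support x)) //; left; exact: cell_support.
  elim/big_ind: _ => [|A B [cA wA] [cB wB]|S Sk].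
  - by split; [exact: closed0|exact: continuous_subspace0].
  - by split; [exact: closedU|exact: withinU_continuous].
  split; first exact: cell_closed.
  have [Sk'|Sk'] := leqP #|S| k.
    have Ssk x : cell S x -> skeleton k x.
      move=> Sx; split; first by case: Sx.
      by apply: leq_trans Sk'; exact/subset_leq_card/support_cell.
    apply: (@subspace_eq_continuous _ _ _ G).
      by move=> x /set_mem Sx; rewrite /from_subspace G'G //; exact: Ssk.
    exact: continuous_subspaceW Gc.
  have {}Sk' : #|S| = k.+1 by apply/eqP; rewrite eqn_leq Sk.
  have [Ec EG _] := EF S Sk'.
  apply: (@subspace_eq_continuous _ _ _ (E S)) => //.
  move=> x /set_mem Sx; rewrite /from_subspace /G' /extend_skeleton.
  case: asboolP => [kx|nkx]; first exact: EG.
  congr (E _ x); apply/esym/eqP; rewrite eqEcard support_cell //= Sk' ltnNge.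
  by apply/negP => xk; apply: nkx; split => //; case: Sx.
move=> x y xy kx ky; rewrite /G' /extend_skeleton.
have sxy := torus_eq_support xy.
case: asboolP => [kx'|nkx]; case: asboolP => [ky'|nky].
- exact: Gper.
- by case: nky; case: kx' => _ h; case: ky => b _; split => //; rewrite -sxy.
- by case: nkx; case: ky' => _ h; case: kx => b _; split => //; rewrite sxy.
rewrite sxy; have sk : #|support y| = k.+1.
  apply/eqP; rewrite eqn_leq (ky.2) /= ltnNge; apply/negP => h; apply: nky.
  by split => //; exact: ky.1.
have [_ _ Eeq] := EF _ sk; apply: Eeq => i; rewrite inE => yi.
by case: (xy i) => // -[_]; rewrite (negPf yi).
Qed.

Section CellCoordinates.
Variables (S : {set I}) (m : nat) (Sm : #|S| = m).

Definition cell_coord (j : 'I_m) : I := enum_val (cast_ord (esym Sm) j).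

Lemma cell_coord_in j : cell_coord j \in S.
Proof. exact: enum_valP. Qed.

Lemma cell_coord_inj : injective cell_coord.
Proof. by move=> j j' /enum_val_inj/cast_ord_inj. Qed.

Lemma cell_coord_surj i : i \in S -> exists j, i = cell_coord j.
Proof.
move=> iS; exists (cast_ord Sm (enum_rank_in iS i)).
by rewrite /cell_coord cast_ordK enum_rankK_in.
Qed.

Definition cell_incl (y : {ptws 'I_m -> R}) : RI := fun i =>
  if [pick j | cell_coord j == i] is Some j then y j else 0.

Definition cell_restr (x : RI) : {ptws 'I_m -> R} := fun j => x (cell_coord j).

Lemma cell_incl_coord y j : cell_incl y (cell_coord j) = y j.
Proof.
rewrite /cell_incl; case: pickP => [j' /eqP/cell_coord_inj->//|/(_ j)].
by rewrite eqxx.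
Qed.

Lemma cell_incl_out y i : i \notin S -> cell_incl y i = 0.
Proof.
rewrite /cell_incl; case: pickP => // j /eqP <-.
by rewrite cell_coord_in.
Qed.

Lemma cell_incl_continuous : continuous cell_incl.
Proof.
apply: ptws_continuous => i; rewrite /cell_incl; case: pickP => [j _|_].
  exact: ptws_eval_continuous.
exact: cst_continuous.
Qed.

Lemma cell_restr_continuous : continuous cell_restr.
Proof. by apply: ptws_continuous => j; exact: ptws_eval_continuous. Qed.

Lemma box_cell_incl y : box y -> box (cell_incl y).
Proof.
move=> yb i; have [iS|iS] := boolP (i \in S); last first.
  by rewrite cell_incl_out // lexx ler01.
by have [j ->] := cell_coord_surj iS; rewrite cell_incl_coord.
Qed.

Lemma cell_incl_restr x : cell S x -> torus_eq (cell_incl (cell_restr x)) x.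
Proof.
move=> [bx xS] i; have [iS|iS] := boolP (i \in S).
  by left; have [j ->] := cell_coord_surj iS; rewrite cell_incl_coord.
by right; rewrite cell_incl_out // /is01 eqxx; split => //; exact: xS.
Qed.

Lemma cell_incl_support y : support (cell_incl y) \subset S.
Proof.
apply/fintype.subsetP => i; rewrite inE; apply: contraR => iS.
by rewrite cell_incl_out // /is01 eqxx.
Qed.

End CellCoordinates.

Lemma cube_cell_filling k G (S : {set I}) (Sk : #|S| = k.+1)
    (E : {ptws 'I_k.+1 -> R} -> X) :
  skeleton_map k G -> {within (@box R 'I_k.+1), continuous E} ->
  (forall y, box_bd y -> E y = G (cell_incl Sk y)) ->
  cell_filling k G S (E \o cell_restr Sk).
Proof.
move=> [Gc Gper G0] Ec EG; split.
- apply: within_comp Ec; first exact: cell_restr_continuous.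
  by move=> x [bx _] j; exact: bx.
- move=> x Sx kx /=; have bd : box_bd (cell_restr Sk x).
    split; first by move=> j; apply: Sx.1.
    have : ~~ (S \subset support x).
      apply/negP => /subset_leq_card; rewrite Sk => h.
      by have := leq_trans h kx.2; rewrite ltnn.
    case/subsetPn => i /(cell_coord_surj Sk)[j ->]; rewrite inE negbK => xj.
    by exists j; case/orP: xj => /eqP; [left|right].
  rewrite EG //; apply: Gper => //; first exact: cell_incl_restr.
  split; first by apply: box_cell_incl; exact: bd.1.
  by rewrite (torus_eq_support (cell_incl_restr Sk Sx)); exact: kx.2.
- by move=> x y xy /=; congr E; apply/funext => j; apply: xy; exact: cell_coord_in.
Qed.

Lemma cell_incl_bd k (S : {set I}) (Sk : #|S| = k.+1) y :
  box_bd y -> skeleton k (cell_incl Sk y).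
Proof.
move=> [by' [j yj]]; split; first exact: box_cell_incl.
have kE : #|S :\ cell_coord Sk j|%SET = k.
  by have := cardsD1 (cell_coord Sk j) S; rewrite Sk cell_coord_in => -[].
rewrite -[X in (_ <= X)%N]kE.
apply: subset_leq_card; rewrite subsetD1 cell_incl_support inE negbK.
by rewrite cell_incl_coord /is01; case: yj => ->; rewrite eqxx ?orbT.
Qed.

Lemma within_cell_incl k G (S : {set I}) (Sk : #|S| = k.+1) : skeleton_map k G ->
  {within (@box_bd R 'I_k.+1), continuous (G \o cell_incl Sk)}.
Proof.
move=> [Gc _ _]; apply: within_comp Gc; first exact: cell_incl_continuous.
exact: cell_incl_bd.
Qed.

End Skeleta.

(** * The torus of a family of commuting loops *)
Section TorusMap.
Variables (R : realType) (X : topologicalType) (x0 : X) (G : groupType).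
Variable phi : (unitI R -> X) -> G.
Hypothesis phi_homotopic : forall f g, is_loop x0 f -> is_loop x0 g ->
  (phi f = phi g <-> homotopic_rel R [set clamp 0; clamp 1] f g).
Hypothesis phi_concat : forall f g, is_loop x0 f -> is_loop x0 g ->
  phi (loop_concat f g) = (phi f * phi g)%g.
Hypothesis pi_triv : forall n : nat, (2 <= n)%N -> pi_trivial R x0 n.

Variables (I : finType) (l : I -> R -> X).
Hypothesis l_continuous : forall i, continuous (l i).
Hypothesis l0 : forall i, l i 0 = x0.
Hypothesis l1 : forall i, l i 1 = x0.
Hypothesis l_commute : forall i j,
  (phi (real_loop (l i)) * phi (real_loop (l j)) =
   phi (real_loop (l j)) * phi (real_loop (l i)))%g.
Local Notation RI := {ptws I -> R}.

Definition axis (i : I) (t : R) : RI := fun j => if j == i then t else 0.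

Lemma l_is01 i t : is01 t -> l i t = x0.
Proof. by case/orP => /eqP ->. Qed.

Lemma torus_eq0 (x : RI) : (forall i, is01 (x i)) -> torus_eq x (fun=> 0).
Proof. by move=> x01 i; right; split; [exact: x01|rewrite /is01 eqxx]. Qed.

Lemma skeleton0_is01 (x : RI) : skeleton 0 x -> forall i, is01 (x i).
Proof.
move=> [_]; rewrite leqn0 cards_eq0 => /eqP s0 i.
have : i \notin support x by rewrite s0 inE.
by rewrite inE negbK.
Qed.

Lemma skeleton_origin k : skeleton k ((fun=> 0) : RI).
Proof.
split=> [i|]; first by rewrite lexx ler01.
by rewrite (_ : support _ = finset.set0) ?cards0 //; apply/setP => i;
  rewrite !inE /is01 eqxx.
Qed.

Lemma skeleton_axis k i t : (0 < k)%N -> 0 <= t <= 1 -> skeleton k (axis i t).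
Proof.
move=> k0 t01; split; first by move=> j; rewrite /axis; case: ifP; rewrite ?lexx ?ler01.
apply: leq_trans k0; rewrite -(cards1 i); apply/subset_leq_card/fintype.subsetP => j.
by rewrite !inE /axis; case: ifP; rewrite ?/is01 ?eqxx.
Qed.

Lemma skeleton1 : exists F : RI -> X, skeleton_map x0 1 F /\
  forall i t, 0 <= t <= 1 -> F (axis i t) = l i t.
Proof.
have base : skeleton_map x0 0 (fun _ : RI => x0).
  by split=> //; apply: continuous_subspaceT; exact: cst_continuous.
pose E (S : {set I}) (x : RI) :=
  if [pick i in S] is Some i then l i (x i) else x0.
have Epick S x i : S = [set i]%SET -> E S x = l i (x i).
  move=> ->; rewrite /E; case: pickP => [j|/(_ i)]; rewrite inE ?eqxx //.
  by move=> /eqP ->.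
have EF (S : {set I}) : #|S| = 1%N -> cell_filling 0 (fun=> x0) S (E S).
  move=> /eqP/cards1P[i Si].
  have EE : E S = fun x => l i (x i) by apply/funext => x; exact: Epick.
  rewrite EE; split.
  - apply: continuous_subspaceT.
    by apply: (continuous_comp_fun (f := fun x : RI => x i)); [exact: ptws_eval_continuous|].
  - by move=> x _ /skeleton0_is01 h; rewrite l_is01.
  - by move=> x y /(_ i); rewrite Si inE eqxx => ->.
have [sm _] := skeleton_step base EF.
exists (extend_skeleton 0 (fun=> x0) E); split=> // i t t01.
rewrite /extend_skeleton; case: asboolP => [/skeleton0_is01/(_ i)|h].
  by rewrite /axis eqxx => /l_is01 ->.
rewrite (@Epick _ _ i); first by rewrite /axis eqxx.
have [ba _] := @skeleton_axis 1 i t isT t01.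
apply/eqP; rewrite eqEcard cards1; apply/andP; split.
  apply/fintype.subsetP => j.
  by rewrite !inE /axis; case: ifP; rewrite ?/is01 ?eqxx.
by rewrite ltnNge; apply/negP => h'; apply: h; split=> //; exact: ba.
Qed.

(** Dimension 2 uses that the loops commute: opposite edges of the square carry
the same loop. In higher dimensions the vanishing of the homotopy groups
applies, since all the vertices of the cube are mapped to the base point. *)
Lemma skeleton_fill k F (S : {set I}) : (0 < k)%N -> skeleton_map x0 k F ->
  (forall i t, 0 <= t <= 1 -> F (axis i t) = l i t) -> #|S| = k.+1 ->
  exists E, cell_filling k F S E.
Proof.
move=> k0 Fk Fl Sk; have wc := within_cell_incl (Sk := Sk) Fk.
suff [E [Ec EF]] : exists E : {ptws 'I_k.+1 -> R} -> X,
    {within (@box R 'I_k.+1), continuous E} /\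
    forall y, box_bd y -> E y = F (cell_incl Sk y).
  by exists (E \o cell_restr Sk); exact: cube_cell_filling Fk Ec EF.
have [Fc Fper F0] := Fk.
have [k1|k1] := ltnP 1 k.
  have H := sphere_filling k0 (pi_triv k1) wc; apply: H => /=.
  have b1 : box_bd ((fun=> 1) : {ptws 'I_k.+1 -> R}).
    by split=> [j|]; [rewrite ler01 lexx|exists ord0; right].
  rewrite -F0; apply: Fper; [|exact: cell_incl_bd|exact: skeleton_origin].
  apply: torus_eq0 => i; have [iS|iS] := boolP (i \in S).
    by have [j ->] := cell_coord_surj Sk iS; rewrite cell_incl_coord /is01 eqxx orbT.
  by rewrite cell_incl_out // /is01 eqxx.
have {k0 k1} kE : k = 1%N by apply/eqP; rewrite eqn_leq k1.
subst k.
pose v0 := cell_coord Sk ord0; pose v1 := cell_coord Sk ord_max.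
have edge (y : {ptws 'I_2 -> R}) (j j' : 'I_2) : (j == ord0) = (j' == ord_max) ->
    box y -> y j' = 0 \/ y j' = 1 -> F (cell_incl Sk y) = l (cell_coord Sk j) (y j).
  move=> jj' by' yj'; rewrite -Fl //; apply: Fper.
  - move=> i; have [iS|iS] := boolP (i \in S); last first.
      left; rewrite cell_incl_out // /axis; case: eqP => // ie.
      by rewrite ie cell_coord_in in iS.
    have [j2 ->] := cell_coord_surj Sk iS; rewrite cell_incl_coord /axis.
    rewrite (inj_eq (@cell_coord_inj _ _ _ Sk)).
    have [->|jj2] := eqVneq j2 j; first by left.
    right; have -> : j2 = j'.
      by case: (ord2 j) (ord2 j') (ord2 j2) jj' jj2 => -> [->|->] [->|->].
    by rewrite /is01 eqxx; case: yj' => ->; rewrite eqxx ?orbT.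
  - by apply: cell_incl_bd; split => //; exists j'.
  - exact: skeleton_axis.
apply: (square_filling phi_homotopic phi_concat (a := l v0) (b := l v1)) => //.
- by move=> y yb h; apply: edge h.
- by move=> y yb h; apply: edge h.
Qed.

Lemma skeleton_exists k : exists F : RI -> X, skeleton_map x0 k.+1 F /\
  forall i t, 0 <= t <= 1 -> F (axis i t) = l i t.
Proof.
elim: k => [|k [F [Fk Fl]]]; first exact: skeleton1.
have /choice[E EP] : forall S : {set I}, exists E,
    #|S| = k.+2 -> cell_filling k.+1 F S E.
  move=> S; have [Sk|Sk] := pselect (#|S| = k.+2).
    by have [E ?] := skeleton_fill (ltn0Sn k) Fk Fl Sk; exists E.
  by exists F.
have [sm GF] := skeleton_step Fk EP.
exists (extend_skeleton k.+1 F E); split => // i t t01.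
by rewrite GF ?Fl //; exact: skeleton_axis.
Qed.

Lemma box_map : exists F : RI -> X,
  [/\ {within (@box R I), continuous F},
      forall x y, torus_eq x y -> box x -> box y -> F x = F y,
      F (fun=> 0) = x0
    & forall i t, 0 <= t <= 1 -> F (axis i t) = l i t].
Proof.
have [F [[Fc Fper F0] Fl]] := skeleton_exists #|I|.
have sk (x : RI) : box x -> skeleton #|I|.+1 x.
  by move=> bx; split => //; apply: leqW; exact: max_card.
exists F; split => //.
  exact: continuous_subspaceW Fc.
by move=> x y xy /sk kx /sk; exact: Fper.
Qed.

(** Near t the floor takes at most one other value, and only if t is an
integer. *)
Lemma near_floor (t : R) : \forall u \near t, Num.floor u = Num.floor t \/
  (t = (Num.floor t)%:~R /\ Num.floor u = Num.floor t - 1).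
Proof.
have /andP[f1 f2] := floor_itv t; rewrite intrD in f2.
have n2 : \forall u \near t, u < (Num.floor t)%:~R + 1 by exact: lt_nbhsl.
have [tE|tN] := eqVneq t (Num.floor t)%:~R.
  have n1 : \forall u \near t, (Num.floor t)%:~R - 1 < u.
    by apply: lt_nbhsr; rewrite {2}tE; lra.
  apply: filter_app n2; apply: filterS n1 => u u1 u2.
  have [u0|u0] := lerP (Num.floor t)%:~R u.
    by left; apply: floor_def; rewrite u0 intrD.
  right; split => //; apply: floor_def; rewrite subrK u0 intrB.
  by rewrite (ltW u1).
have n1 : \forall u \near t, (Num.floor t)%:~R < u.
  by apply: lt_nbhsr; rewrite lt_neqAle eq_sym tN.
apply: filter_app n2; apply: filterS n1 => u u1 u2.
by left; apply: floor_def; rewrite (ltW u1) intrD.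
Qed.

(** The map of the cube is composed with the fractional part. *)
Lemma torus_map : exists g : RI -> X,
  [/\ continuous g,
      forall (x : RI) (a : I -> int), g (fun i => x i + (a i)%:~R) = g x,
      g (fun=> 0) = x0
    & forall i t, 0 <= t <= 1 -> g (axis i t) = l i t].
Proof.
have [F [Fc Fper F0 Fl]] := box_map.
pose clampv (x : RI) : RI := fun i => unit_clamp (x i).
have clampv_box x : box (clampv x) by move=> i; exact: set_val_itv.
have clampvK (x : RI) : box x -> clampv x = x.
  by move=> bx; apply/funext => i; rewrite /clampv unit_clampK.
pose F' (x : RI) := F (clampv x).
have F'c : continuous F'.
  apply: (comp_within_continuous _ clampv_box Fc); apply: ptws_continuous => i.
  apply: (continuous_comp_fun (f := fun x : RI => x i)).
    exact: ptws_eval_continuous.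
  exact: unit_clamp_continuous.
pose fracv (x : RI) : RI := fun i => x i - (Num.floor (x i))%:~R.
have frac_box x : box (fracv x).
  move=> i; have := floor_itv (x i); rewrite intrD /fracv; lra.
exists (F \o fracv); split.
(* Near x only the finitely many unit cubes around x matter; b records the
   coordinates in which the floor drops by 1, and the translates of the map of
   the cube that are defined at x agree there by periodicity. *)
- move=> x U Ux; rewrite nbhs_simpl /=.
  pose a (b : {ffun I -> bool}) i : R := (Num.floor (x i))%:~R - (b i)%:R.
  pose sh b (y : RI) : RI := fun i => y i - a b i.
  have shc b : continuous (sh b).
    apply: ptws_continuous => i.
    exact: (sub_cst_continuous (f := fun y : RI => y i) (@ptws_eval_continuous R I i)).
  have n1 : \forall y \near x, forall b, box (sh b x) -> U (F' (sh b y)).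
    apply: (@filter_forall _ _ (fun (b : {ffun I -> bool}) (y : RI) =>
      box (sh b x) -> U (F' (sh b y))) (nbhs x) _) => b.
    have [bb|nb] := pselect (box (sh b x)); last by apply: nearW.
    have : nbhs (F' (sh b x)) U.
      move: Ux; rewrite /F' clampvK //=; congr (nbhs _ U); apply: Fper => // i.
      have := bb i; rewrite /sh /a /fracv; case: (b i) => /=; last by left; ring.
      have := floor_itv (x i); rewrite intrD /is01 => f1 f2; right; split.
        by apply/orP; left; rewrite subr_eq0; apply/eqP; lra.
      by apply/orP; right; apply/eqP; lra.
    have shF : continuous (fun y => F' (sh b y)) by exact: continuous_comp_fun (shc b) F'c.
    by move=> /(shF x); rewrite nbhs_simpl /=; apply: filterS.
  have n2 : \forall y \near x, forall i, Num.floor (y i) = Num.floor (x i) \/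
      (x i = (Num.floor (x i))%:~R /\ Num.floor (y i) = Num.floor (x i) - 1).
    apply: (@filter_forall _ _ (fun i (y : RI) => Num.floor (y i) = Num.floor (x i) \/
      (x i = (Num.floor (x i))%:~R /\ Num.floor (y i) = Num.floor (x i) - 1)) (nbhs x) _) => i.
    exact: (@ptws_eval_continuous R I i x _ (near_floor (x i))).
  apply: (@filterS _ (nbhs x) _ _ _ _ (@filterI _ (nbhs x) _ _ _ n1 n2)) => y [y1 y2].
  pose b := [ffun i => Num.floor (y i) != Num.floor (x i)].
  have aE i : a b i = (Num.floor (y i))%:~R.
    rewrite /a ffunE; case: (y2 i) => [->|[_ ->]]; first by rewrite eqxx subr0.
    by rewrite intrB; case: eqP => [/eqP|//]; rewrite -subr_eq0 addrAC subrr.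
  have bx : box (sh b x).
    move=> i; rewrite /sh aE; have := floor_itv (x i); rewrite intrD.
    case: (y2 i) => [->|[xE ->]]; first by lra.
    rewrite intrB => _; lra.
  have fE : fracv y = sh b y by apply/funext => i; rewrite /sh aE.
  by move: (y1 b bx); rewrite -fE /F' clampvK //; exact: frac_box.
- move=> x c /=; congr F; apply/funext => i; rewrite /fracv floorDrz ?intr_int //.
  by rewrite intrKfloor intrD; ring.
- rewrite /= -F0; congr F; apply/funext => i; rewrite /fracv.
  by rewrite floor0 subr0.
- move=> i t t01 /=; rewrite -Fl //; apply: Fper => // [j|]; last first.
    by move=> j; rewrite /axis; case: ifP; rewrite ?lexx ?ler01.
  rewrite /fracv /axis; case: eqP => _; last by left; rewrite floor0 subr0.
  have [->|t1] := eqVneq t 1.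
    by right; rewrite floor1 subrr /is01 !eqxx orbT.
  left; rewrite (@floor_def _ _ 0) ?subr0 // add0r.
  by case/andP: t01 => -> t1'; rewrite lt_neqAle t1.
Qed.
End TorusMap.

(** * Classes of loops in tori, up to conjugation *)

Lemma additive_combination (B A : zmodType) (f : B -> A) (J : finType)
    (F : J -> B) (n : J -> int) :
  {morph f : x y / x + y} ->
  f (\sum_j F j *~ n j) = \sum_j f (F j) *~ n j.
Proof.
move=> fD; have f0 : f 0 = 0 by apply: (addIr (f 0)); rewrite -fD !add0r.
have fN x : f (- x) = - f x.
  by apply: (addIr (f x)); rewrite -fD !addNr f0.
have fMn x (k : nat) : f (x *+ k) = f x *+ k.
  by elim: k => [|k IH]; rewrite ?mulr0n // !mulrS fD IH.
rewrite (big_morph f fD f0); apply: eq_bigr => j _.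
by case: (n j) => k; rewrite ?NegzE ?mulrNz -?pmulrn ?fN fMn.
Qed.

Section LoopClasses.
Variables (R : realType) (X : topologicalType) (x0 : X) (G : groupType).
Variable phi : (unitI R -> X) -> G.
Hypothesis phi_homotopic : forall f g, is_loop x0 f -> is_loop x0 g ->
  (phi f = phi g <-> homotopic_rel R [set clamp 0; clamp 1] f g).
Hypothesis phi_concat : forall f g, is_loop x0 f -> is_loop x0 g ->
  phi (loop_concat f g) = (phi f * phi g)%g.
Variables (A : zmodType) (ab : G -> A).
Hypothesis abM : forall a b, ab (a * b)%g = ab a + ab b.

Definition periodic (I : Type) (g : {ptws I -> R} -> X) :=
  forall (x : {ptws I -> R}) (a : I -> int), g (fun i => x i + (a i)%:~R) = g x.

Definition line (I : Type) (g : {ptws I -> R} -> X) (a : I -> int) : unitI R -> X :=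
  real_loop (fun t => g (fun i => t * (a i)%:~R)).

Lemma periodic_lattice (I : Type) g (a : I -> int) : periodic g ->
  g (fun=> 0) = x0 -> g (fun i => (a i)%:~R) = x0.
Proof.
move=> gp <-; rewrite -(gp (fun=> 0) a); congr g; apply/funext => i.
by rewrite add0r.
Qed.

Lemma line_end (I : Type) (g : {ptws I -> R} -> X) (a : I -> int) (u : R) :
  periodic g -> g (fun=> 0) = x0 -> u = 0 \/ u = 1 ->
  g (fun i => u * (a i)%:~R) = x0.
Proof.
move=> gp g0 [->|->].
  by rewrite -g0; congr g; apply/funext => i; rewrite mul0r.
by rewrite -(periodic_lattice a gp g0); congr g; apply/funext => i; exact: mul1r.
Qed.

(** The straight line to a + b is the diagonal of the parallelogram spanned by a
and b, two sides of which are, by periodicity, the lines to a and to b. *)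
Lemma line_classD (I : Type) (g : {ptws I -> R} -> X) (a b : I -> int) :
  continuous g -> periodic g -> g (fun=> 0) = x0 ->
  ab (phi (line g (fun i => a i + b i))) = ab (phi (line g a)) + ab (phi (line g b)).
Proof.
move=> gc gp g0.
pose K (st : R * R) := g (fun i => st.2 * (a i)%:~R + st.1 * (b i)%:~R).
have Kc : continuous K.
  apply: (continuous_comp_fun (f := fun st : R * R =>
    (fun i => st.2 * (a i)%:~R + st.1 * (b i)%:~R) : {ptws I -> R})) => //.
  apply: ptws_continuous => i; apply: add_continuous; apply: linear_continuous.
    exact: snd_continuous.
  exact: fst_continuous.
have K0 t : K (0, t) = g (fun i => t * (a i)%:~R).
  by rewrite /K /=; congr g; apply/funext => i; rewrite mul0r addr0.
have K1 t : K (t, 1) = g (fun i => t * (b i)%:~R).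
  by rewrite /K /= -[RHS](gp _ a); congr g; apply/funext => i; rewrite mul1r addrC.
have Kd t : K (t, t) = g (fun i => t * (a i + b i)%:~R).
  by rewrite /K /=; congr g; apply/funext => i; rewrite intrD mulrDr.
have := diagonal_rule phi_homotopic phi_concat Kc.
rewrite K0 [K (0, 1)]K0 Kd !line_end //; try by [left|right].
move=> /(_ erefl erefl erefl)/(congr1 ab); rewrite abM => h.
rewrite /line; under eq_fun do rewrite -Kd.
rewrite -h; congr (ab (phi (real_loop _)) + ab (phi (real_loop _))).
  by apply/funext => t; rewrite K0.
by apply/funext => t; rewrite K1.
Qed.

Lemma line_class (I : finType) (g : {ptws I -> R} -> X) (l : I -> R -> X)
    (a : I -> int) :
  continuous g -> periodic g -> g (fun=> 0) = x0 ->
  (forall i t, 0 <= t <= 1 -> g (axis i t) = l i t) ->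
  ab (phi (line g a)) = \sum_i ab (phi (real_loop (l i))) *~ a i.
Proof.
move=> gc gp g0 gl.
pose e (i : I) : {ffun I -> int} := [ffun j => (j == i)%:R].
have -> : line g a = line g (\sum_i e i *~ a i : {ffun I -> int}).
  congr line; apply/funext => j; rewrite sum_ffunE (bigD1 j) //= big1 => [|i ij].
    by rewrite addr0 ffunMzE ffunE eqxx intz.
  by rewrite ffunMzE ffunE eq_sym (negPf ij) mul0rz.
rewrite (@additive_combination _ _ (fun b : {ffun I -> int} => ab (phi (line g b)))).
  apply: eq_bigr => i _; congr (ab (phi _) *~ _); apply/funext => t.
  rewrite /line /real_loop -gl ?set_val_itv //; congr g; apply/funext => j.
  by rewrite ffunE /axis; case: eqP => _; rewrite ?mulr1 ?mulr0.
move=> b c /=; rewrite -line_classD //; congr (ab (phi (line g _))).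
by apply/funext => i; rewrite ffunE.
Qed.

(** H is a free homotopy from the image of the path c1 to that of c2. Two more
squares contract these paths linearly to the straight lines to a1 and to a2;
periodicity makes the two remaining sides of each square equal. In the square
composed of the three, two opposite sides coincide, so the other two are
conjugate and have the same image in any abelian group. *)
Lemma free_homotopy_class (I1 I2 : Type) (g1 : {ptws I1 -> R} -> X)
    (g2 : {ptws I2 -> R} -> X) (c1 : R -> {ptws I1 -> R}) (c2 : R -> {ptws I2 -> R})
    (a1 : I1 -> int) (a2 : I2 -> int) (H : R * R -> X) :
  continuous g1 -> periodic g1 -> g1 (fun=> 0) = x0 ->
  continuous g2 -> periodic g2 -> g2 (fun=> 0) = x0 ->
  (forall i, continuous (fun t => c1 t i)) ->
  (forall i, continuous (fun t => c2 t i)) -> continuous H ->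
  (forall i, c1 1 i = c1 0 i + (a1 i)%:~R) ->
  (forall i, c2 1 i = c2 0 i + (a2 i)%:~R) ->
  (forall t, H (0, t) = g1 (c1 t)) -> (forall t, H (1, t) = g2 (c2 t)) ->
  (forall s, H (s, 0) = H (s, 1)) ->
  ab (phi (line g1 a1)) = ab (phi (line g2 a2)).
Proof.
move=> g1c g1p g10 g2c g2p g20 c1c c2c Hc c1E c2E H0 H1 H01.
(* The three squares, in the strips s <= 1/3, 1/3 <= s <= 2/3 and 2/3 <= s. *)
pose K1 (st : R * R) := g1 (fun i =>
  (1 - 3 * st.1) * (st.2 * (a1 i)%:~R) + (3 * st.1) * c1 st.2 i).
pose K2 (st : R * R) := H (3 * st.1 - 1, st.2).
pose K3 (st : R * R) := g2 (fun i =>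
  (3 - 3 * st.1) * c2 st.2 i + (3 * st.1 - 2) * (st.2 * (a2 i)%:~R)).
pose K (st : R * R) := if st.1 <= 3^-1 then K1 st else
  if st.1 <= 2 / 3 then K2 st else K3 st.
have affc a b : continuous (fun st : R * R => a * st.1 + b).
  exact: (continuous_comp_fun (@fst_continuous R R) (@affine_continuous R a b)).
have cc (I : Type) (c : R -> {ptws I -> R}) i : continuous (fun t => c t i) ->
    continuous (fun st : R * R => c st.2 i).
  by move=> h; exact: (continuous_comp_fun (@snd_continuous R R) h).
have K1c : continuous K1.
  apply: (continuous_comp_fun (f := fun st : R * R => (fun i =>
    (1 - 3 * st.1) * (st.2 * (a1 i)%:~R) + (3 * st.1) * c1 st.2 i) : {ptws I1 -> R})) => //.
  apply: ptws_continuous => i; apply: add_continuous; apply: mul_continuous.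
  - by under eq_fun do rewrite addrC -mulNr; exact: affc.
  - by apply: linear_continuous; exact: snd_continuous.
  - by under eq_fun do rewrite -[3 * _]addr0; exact: affc.
  - exact: cc.
have K2c : continuous K2.
  apply: (continuous_comp_fun (f := fun st : R * R => (3 * st.1 - 1, st.2))) => //.
  by apply: pair_continuous; [exact: affc|exact: snd_continuous].
have K3c : continuous K3.
  apply: (continuous_comp_fun (f := fun st : R * R => (fun i =>
    (3 - 3 * st.1) * c2 st.2 i + (3 * st.1 - 2) * (st.2 * (a2 i)%:~R)) : {ptws I2 -> R})) => //.
  apply: ptws_continuous => i; apply: add_continuous; apply: mul_continuous.
  - by under eq_fun do rewrite addrC -mulNr; exact: affc.
  - exact: cc.
  - exact: affc.
  - by apply: linear_continuous; exact: snd_continuous.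
have Kc : continuous K.
  apply: glue_continuous => //; first exact: fst_continuous.
    apply: glue_continuous => //; first exact: fst_continuous.
    move=> [s t] /= ->; rewrite /K2 /K3 /=.
    rewrite (_ : 3 * (2 / 3) - 1 = 1) ?H1; last by field.
    by congr g2; apply/funext => i; field.
  move=> [s t] /= ->; rewrite ifT; last by lra.
  rewrite /K1 /K2 /= (_ : 3 * 3^-1 - 1 = 0) ?H0; last by field.
  by congr g1; apply/funext => i; field.
have K01 s : 0 <= s <= 1 -> K (s, 0) = K (s, 1).
  move=> s01; rewrite /K /=; case: ifP => _; last case: ifP => _.
  - rewrite /K1 /= -[LHS](g1p _ a1); congr g1; apply/funext => i.
    by rewrite c1E; ring.
  - by rewrite /K2 /= H01.
  - rewrite /K3 /= -[LHS](g2p _ a2); congr g2; apply/funext => i.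
    by rewrite c2E; ring.
have K0 t : K (0, t) = g1 (fun i => t * (a1 i)%:~R).
  rewrite /K ifT /=; last by lra.
  by rewrite /K1 /=; congr g1; apply/funext => i; ring.
have Kr t : K (1, t) = g2 (fun i => t * (a2 i)%:~R).
  rewrite /K ifF /=; last by apply/negP; lra.
  rewrite ifF /=; last by apply/negP; lra.
  by rewrite /K3 /=; congr g2; apply/funext => i; ring.
have := square_rule phi_homotopic phi_concat Kc.
rewrite !K0 !Kr !line_end //; try by [left|right].
move=> /(_ erefl erefl erefl erefl)/(congr1 ab); rewrite !abM.
have -> : real_loop (fun t => K (t, 0)) = real_loop (fun t => K (t, 1)) :> (unitI R -> X).
  by apply/funext => t; rewrite /real_loop K01 // set_val_itv.
rewrite addrC => /addrI; rewrite /line => h.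
have -> : (fun t => g1 (fun i => t * (a1 i)%:~R)) = (fun t => K (0, t)).
  by apply/funext => t; rewrite K0.
rewrite h; congr (ab (phi (real_loop _))); apply/funext => t; exact: Kr.
Qed.

End LoopClasses.

(** * Invariant open covers without essential paths *)

(** If no path in an invariant set W joins two distinct points of an orbit of integer translations,
then the set of path components of W is a free set for these translations, and
the choice of a point in each orbit gives coordinates in the integers. *)
Section Developing.
Variables (R : realType) (D : eqType).
Local Notation RD := {ptws D -> R}.

Definition shift (x : RD) (a : D -> int) : RD := fun d => x d + (a d)%:~R.

Definition joined (W : set RD) (x y : RD) : Prop :=
  exists c : R -> RD, [/\ continuous c, forall t, W (c t), c 0 = x & c 1 = y].

(** In the torus: every loop in the image of W is null homotopic. *)
Definition no_essential_path (W : set RD) : Prop :=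
  forall x a, joined W x (shift x a) -> a = fun=> 0.

Lemma joined_refl W x : W x -> joined W x x.
Proof. by move=> Wx; exists (fun=> x); split => //; exact: cst_continuous. Qed.

Lemma joined_sym W x y : joined W x y -> joined W y x.
Proof.
move=> [c [cc Wc c0 c1]]; exists (fun t => c (- 1 * t + 1)); split => //.
- exact: (continuous_comp_fun (@affine_continuous R (- 1) 1) cc).
- by rewrite mulr0 add0r.
- by rewrite mulr1 addNr.
Qed.

Lemma joined_trans W y x z : joined W x y -> joined W y z -> joined W x z.
Proof.
move=> [c [cc Wc c0 c1]] [d [dc Wd d0 d1]].
exists (fun t => if t <= 2^-1 then c (2 * t + 0) else d (2 * t - 1)); split.
- apply: (glue_continuous (s := fun t : R => t) (f := fun t => c (2 * t + 0))).
  + by move=> t; exact: cvg_id.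
  + exact: (continuous_comp_fun (@affine_continuous R 2 0) cc).
  + exact: (continuous_comp_fun (@affine_continuous R 2 (- 1)) dc).
  + by move=> t ->; rewrite mulfV // addr0 subrr c1 d0.
- by move=> t; case: ifP.
- by rewrite invr_ge0 ler0n mulr0 addr0.
- rewrite ifF; last by apply/negP; lra.
  by rewrite (_ : 2 * 1 - 1 = 1) //; ring.
Qed.

Lemma shiftD x a b : shift (shift x a) b = shift x (fun d => a d + b d).
Proof. by apply/funext => d; rewrite /shift intrD addrA. Qed.

Lemma shift_continuous (a : D -> int) (c : R -> RD) : continuous c ->
  continuous (fun t => shift (c t) a).
Proof.
move=> cc; apply: ptws_continuous => d; apply: add_continuous; last first.
  exact: cst_continuous.
exact: (continuous_comp_fun cc (@ptws_eval_continuous R _ d)).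
Qed.

Variable W : set RD.
Hypothesis W_shift : forall x a, W x -> W (shift x a).
Hypothesis W_path : no_essential_path W.

Lemma joined_shift x y a : joined W x y -> joined W (shift x a) (shift y a).
Proof.
move=> [c [cc Wc c0 c1]]; exists (fun t => shift (c t) a); split.
- exact: shift_continuous.
- by move=> t; exact: W_shift.
- by rewrite c0.
- by rewrite c1.
Qed.

(** The points that are joined to a translate of x. *)
Definition orbit_class (x : RD) : set RD :=
  [set y | exists a, joined W x (shift y a)].

Definition orbit_repr (x : RD) : RD := xget (fun=> 0) (orbit_class x).

(** The translation that takes the chosen point of the orbit to the component of
[x]. *)
Definition developing (x : RD) : D -> int :=
  xget (fun=> 0) [set a | joined W x (shift (orbit_repr x) a)].

Lemma developingP x : W x -> joined W x (shift (orbit_repr x) (developing x)).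
Proof.
move=> Wx; have [a ha] : exists a, joined W x (shift (orbit_repr x) a).
  rewrite /orbit_repr; case: xgetP => [y _ //|/(_ x)[]].
  exists (fun=> 0); rewrite (_ : shift x _ = x); first exact: joined_refl.
  by apply/funext => d; rewrite /shift addr0.
by rewrite /developing; case: xgetP => [b _ //|/(_ a)[]].
Qed.

Lemma developing_unique x a b :
  joined W x (shift (orbit_repr x) a) -> joined W x (shift (orbit_repr x) b) -> a = b.
Proof.
move=> /joined_sym xa xb; have := joined_trans xa xb.
have -> : shift (orbit_repr x) b = shift (shift (orbit_repr x) a) (fun d => b d - a d).
  by rewrite shiftD; congr shift; apply/funext => d; rewrite addrC subrK.
move=> /W_path ab; apply/funext => d; apply/eqP; rewrite eq_sym -subr_eq0.
by have := congr1 (fun f => f d) ab => /= ->.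
Qed.

Lemma developing_joined x y : joined W x y -> developing x = developing y.
Proof.
move=> xy.
have cxy : orbit_class x = orbit_class y.
  apply/seteqP; split => z [a h]; exists a; last exact: joined_trans h.
  exact: joined_trans (joined_sym xy) h.
have rxy : orbit_repr x = orbit_repr y by rewrite /orbit_repr cxy.
rewrite /developing rxy; congr xget; apply/seteqP; split => a h /=.
  exact: joined_trans (joined_sym xy) h.
exact: joined_trans h.
Qed.

Lemma developing_shift x a : W x ->
  developing (shift x a) = fun d => developing x d + a d.
Proof.
move=> Wx.
have shiftK z b : shift (shift z b) (fun d => - b d) = z.
  by rewrite shiftD; apply/funext => d; rewrite /shift subrr addr0.
have cxa : orbit_class (shift x a) = orbit_class x.
  apply/seteqP; split => z [b h].
    exists (fun d => b d - a d); rewrite -shiftD -[x](shiftK _ a).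
    exact: joined_shift.
  by exists (fun d => b d + a d); rewrite -shiftD; exact: joined_shift.
have rxa : orbit_repr (shift x a) = orbit_repr x by rewrite /orbit_repr cxa.
apply: (@developing_unique (shift x a)); first exact/developingP/W_shift.
by rewrite rxa -shiftD; apply/joined_shift/developingP.
Qed.

End Developing.

Section Covering.
Variables (R : realType) (D : finType) (k : nat).
Local Notation RD := {ptws D -> R}.
Variable W : 'I_k.+1 -> set RD.
Hypothesis W_open : forall i, open (W i).
Hypothesis W_cover : forall x, exists i, W i x.
Hypothesis W_shift : forall i x a, W i x -> W i (shift x a).
Hypothesis W_path : forall i, no_essential_path (W i).

Lemma box_compact : compact (@box R D).
Proof.
have := @tychonoff D (fun=> R) (fun=> `[0, 1]%classic) (fun=> @segment_compact R 0 1).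
congr compact; apply/seteqP; split => x h i; have := h i;
  by rewrite /= in_itv.
Qed.

(** A Lebesgue number for the cover of the compact unit cube. *)
Lemma lebesgue_number : exists2 M : nat, (1 < M)%N &
  forall x : RD, box x -> exists i, forall y : RD,
    (forall d, `|y d - x d| <= M%:R^-1) -> W i y.
Proof.
pose P (M : nat) (x : RD) := exists i, forall y : RD,
    (forall d, `|y d - x d| <= M.+1%:R^-1) -> W i y.
have cP : \forall M \near \oo, @box R D `<=` P M.
  apply: (proj1 (compact_near_coveringP _) box_compact) => x _.
  have [i Wx] := W_cover x.
  have [e e0 eW] := box_nbhs (open_nbhs_nbhs (conj (W_open i) Wx)).
  have e20 : 0 < e / 2 by rewrite divr_gt0.
  exists ([set x' : RD | forall d, `|x' d - x d| < e / 2],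
          [set M : nat | M.+1%:R^-1 < e / 2]) => /=.
    split; last exact: near_infty_natSinv_lt (PosNum e20).
    apply: (@filter_forall _ _ (fun d (x' : RD) => `|x' d - x d| < e / 2)
      (nbhs x) _) => d.
    apply: (@ptws_eval_continuous R D d x [set u | `|u - x d| < e / 2]).
    by exists (e / 2) => //= u; rewrite /= distrC.
  move=> [x' M] /= [xx' Me]; exists i => y yx'; apply: eW => d.
  have -> : y d - x d = (y d - x' d) + (x' d - x d) by ring.
  by apply: le_lt_trans (ler_normD _ _) _; move: (le_lt_trans (yx' d) Me) (xx' d); lra.
have [N _ NP] := cP; exists (maxn N 1).+1; first by rewrite ltnS leq_max orbT.
by move=> x bx; apply: (NP (maxn N 1)) => //=; rewrite leq_maxl.
Qed.

(** The lattice point v stands for v / M, where 1 / M is a Lebesgue number. Its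
colour depends only on its fractional part, so it is invariant under
translations. Neighbours of the same colour are joined by a segment inside the
set of that colour. *)
Lemma covering_dimension : (#|D| <= k)%N.
Proof.
rewrite leqNgt; apply/negP => kD.
have [M M1 Mleb] := lebesgue_number.
have M0 : (M%:R : R) != 0 by rewrite pnatr_eq0 -lt0n (ltn_trans _ M1).
have /choice[col0 col0P] : forall x : RD, exists i, box x -> forall y : RD,
    (forall d, `|y d - x d| <= M%:R^-1) -> W i y.
  move=> x; have [/Mleb[i h]|nb] := pselect (box x); first by exists i.
  by exists ord0.
pose flo (x : RD) (d : D) : int := Num.floor (x d).
pose fra (x : RD) : RD := shift x (fun d => - flo x d).
have fra_shift x a : fra (shift x a) = fra x.
  apply/funext => d; rewrite /fra /shift /flo floorDrz ?intr_int //.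
  by rewrite intrKfloor !intrN intrD; ring.
have fra_box x : box (fra x).
  by move=> d; rewrite /fra /shift /flo intrN; have := floor_itv (x d); rewrite intrD; lra.
pose col x := col0 (fra x).
have colP (x y : RD) : (forall d, `|y d - x d| <= M%:R^-1) -> W (col x) y.
  move=> yx; have -> : y = shift (shift y (fun d => - flo x d)) (flo x).
    by rewrite shiftD; apply/funext => d; rewrite /shift addNr addr0.
  apply: W_shift; apply: col0P => // d.
  by rewrite /fra /shift opprD addrACA subrr addr0.
pose pt (v : 'rV[int]_#|D|) : RD := fun d => (v 0 (enum_rank d))%:~R / M%:R.
pose dev i := developing (W i).
pose h (v : 'rV[int]_#|D|) : 'rV[int]_#|D| :=
  \row_j dev (col (pt v)) (pt v) (enum_val j).
have pt_shift v j : pt (v + M%:Z *: delta_mx 0 j) =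
    shift (pt v) (fun d => (enum_rank d == j)%:R).
  apply/funext => d; rewrite /pt /shift !mxE intrD mulrDl; congr (_ + _).
  rewrite eqxx /= intrM mulrAC -pmulrn divff // mul1r.
  by case: (_ == _).
have Wcol x : W (col x) x.
  by apply: colP => d; rewrite subrr normr0 invr_ge0 ler0n.
apply: (@lattice_colouring #|D| k M h (fun v => col (pt v)) M1 kD).
  move=> v j; apply/rowP => j'; rewrite !mxE pt_shift.
  rewrite {1}/col fra_shift -/(col _) /dev developing_shift //; last exact: W_shift.
  by rewrite enum_valK eqxx.
move=> v w vw cvw; apply/rowP => j; rewrite !mxE -cvw.
suff : joined (W (col (pt v))) (pt v) (pt w).
  by move=> /developing_joined; rewrite /dev => ->.
exists (fun t d => pt v d + unit_clamp t * (pt w d - pt v d)); split.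
- apply: ptws_continuous => d; apply: add_continuous; first exact: cst_continuous.
  by apply: linear_continuous; exact: unit_clamp_continuous.
- move=> t; apply: colP => d; rewrite addrAC subrr add0r.
  have /andP[t0 t1] : 0 <= unit_clamp t <= 1 by exact: set_val_itv.
  rewrite normrM (ger0_norm t0).
  have : `|pt w d - pt v d| <= M%:R^-1.
    rewrite /pt -mulrBl -intrB normrM [X in _ * X]ger0_norm ?invr_ge0 ?ler0n //.
    have := vw (enum_rank d); rewrite !mxE => /orP[] /eqP ->.
      by rewrite normr0 mul0r invr_ge0 ler0n.
    by rewrite normr1 mul1r.
  have := normr_ge0 (pt w d - pt v d); nra.
- by apply/funext => d; rewrite unit_clamp_le0 // mul0r addr0.
- by apply/funext => d; rewrite unit_clamp_ge1 // mul1r addrC subrK.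
Qed.

End Covering.

(** * Abelianization of the Artin group *)
Section Abelianization.
Variables (V : finType) (E : rel V).

Definition letter_exponent (a : V * bool) : {ffun V -> int} :=
  [ffun v => if a.1 == v then (-1) ^+ ~~ a.2 else 0].

Definition word_exponent (w : word V) : {ffun V -> int} :=
  \sum_(a <- w) letter_exponent a.

Lemma word_exponent_eqv x y : word_eqv (raag_rel E) x y ->
  word_exponent x = word_exponent y.
Proof.
rewrite /word_exponent; elim=> {x y} //.
- by move=> y x z _ -> _ ->.
- by move=> x x' y y' _ xx' _ yy'; rewrite !big_cat /= xx' yy'.
- move=> v b; rewrite !big_cons !big_nil addr0.
  apply/ffunP => u; rewrite !ffunE /=; case: eqP => _; last by rewrite addr0.
  by case: b.
- move=> _ _ [v [w [_ -> ->]]]; rewrite !big_cons !big_nil !addr0.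
  exact: addrC.
Qed.

Definition abelianization (a : raag E) : {ffun V -> int} :=
  word_exponent (repr (a : presented_group (raag_rel E))).

Lemma abelianization_class w :
  abelianization (word_class (raag_rel E) w) = word_exponent w.
Proof. exact/word_exponent_eqv/repr_word_class. Qed.

Lemma abelianizationM (a b : raag E) :
  abelianization (a * b)%g = abelianization a + abelianization b.
Proof. by rewrite abelianization_class /word_exponent big_cat. Qed.

Definition generator (v : V) : raag E := word_class (raag_rel E) [:: (v, true)].

Lemma abelianization_generator v :
  abelianization (generator v) = [ffun u => (v == u)%:R].
Proof.
rewrite abelianization_class /word_exponent big_seq1; apply/ffunP => u.
by rewrite !ffunE /= expr0; case: eqP.
Qed.

Lemma generator_commute v w : (v == w) || E v w ->
  (generator v * generator w = generator w * generator v)%g.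
Proof.
case/predU1P => [->//|vw].
rewrite [LHS]pgroup_mulE [RHS]pgroup_mulE; apply/eqP/word_classP/word_eqv_rel.
by exists v, w.
Qed.
End Abelianization.

(** * Local sections and the lower bound *)
Section Sections.
Variables (R : realType) (X : topologicalType).

Lemma unitI_locally_compact : locally_compact [set: unitI R].
Proof.
move=> t _; rewrite withinET; exists setT; first exact: filterT.
by split; [exact: unitI_compact|exact: closedT].
Qed.

Import ArrowAsCompactOpen.

(** The paths chosen by the section over [f], by the exponential law for the
compact-open topology. *)
Lemma section_homotopy (r : nat) (U : set {ptws 'I_r -> X})
    (s : U -> path_space R X) (f : R -> {ptws 'I_r -> X}) :
  continuous s -> (forall u : U, path_eval r (s u) = set_val u) ->
  continuous f -> (forall t, U (f t)) ->
  exists P : R * unitI R -> X,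
    [/\ continuous P,
        forall t (j : 'I_r), P (t, clamp (j%:R / r.-1%:R)) = f t j
      & forall t t', f t = f t' -> forall u, P (t, u) = P (t', u)].
Proof.
move=> sc sE fc fU.
pose lift t : U := exist _ (f t) (mem_set (fU t)).
have liftc : continuous lift by exact: continuous_comp_initial.
pose p t : unitI R -> X := s (lift t).
have pc : continuous (p : R -> {compact-open, unitI R -> X}).
  have h := continuous_comp_fun liftc sc.
  apply: (continuous_comp_fun h (g := fun g : path_space R X =>
    (g : unitI R -> X) : {compact-open, unitI R -> X})).
  exact: initial_continuous.
exists (uncurry p); split.
- apply: continuous_uncurry => //.
  + exact: unitI_locally_compact.
  + exact: unitI_hausdorff.
  + by move=> t; exact: (@cts_fun _ _ (s (lift t))).
- by move=> t j; rewrite /= /p; have := congr1 (fun g => g j) (sE (lift t)).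
- move=> t t' tt' u; rewrite /= /p; congr (s _ u).
  by apply: val_inj.
Qed.
End Sections.

Section LowerBound.
Variables (R : realType) (V : finType) (E : rel V) (r k : nat).
Variables (X : topologicalType) (C : 'I_r -> {set V}).
Hypothesis r_ge2 : (2 <= r)%N.
Hypothesis KX : is_K1 R X (raag E).
Hypothesis C_clique : forall j, clique E (C j).
Hypothesis C_cap : forall v, exists j, v \notin C j.

Local Notation I_ j := {v | v \in C j}.
Local Notation D := {j : 'I_r & I_ j}.
Local Notation RD := {ptws D -> R}.

(** The torus of the j-th clique gives the j-th component of [F], on the
coordinates indexed by that clique. The vector [A j] is the class, in Z^V, of the
j-th loop of a path from [x] to [shift x a]. *)
Lemma clique_sum_le : TC_le R r X k -> ((\sum_j #|C j|) <= k)%N.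
Proof.
move=> [U [Uo Ucov Us]].
have [_ _ [x0 [[phi [phi_homotopic phi_concat phi_surj]] pi_triv]]] := KX.
have /choice[ell ellP] : forall v, exists f, is_loop x0 f /\ phi f = generator E v.
  by move=> v; exact: phi_surj.
pose l v t := ell v (clamp t).
have lE v : real_loop (l v) = ell v.
  by apply/funext => t; rewrite /real_loop /l set_valK.
have lc v : continuous (l v).
  by have [[ec _ _] _] := ellP v; exact: continuous_comp_fun (@clamp_continuous R) ec.
have l0 v : l v 0 = x0 by have [[]] := ellP v.
have l1 v : l v 1 = x0 by have [[]] := ellP v.
have phil v : phi (real_loop (l v)) = generator E v.
  by rewrite lE; have [] := ellP v.
have tor j : exists g : {ptws I_ j -> R} -> X,
    [/\ continuous g, periodic g, g (fun=> 0) = x0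
      & forall i t, 0 <= t <= 1 -> g (axis i t) = l (val i) t].
  apply: (torus_map phi_homotopic phi_concat pi_triv) => // i i'.
  rewrite !phil; apply: generator_commute.
  have [//|/= ii'] := boolP (val i == val i').
  have /forallP/(_ (val i))/implyP/(_ (valP i)) := C_clique j.
  by move=> /forallP/(_ (val i'))/implyP/(_ (valP i'))/implyP; apply.
pose g j := projT1 (cid (tor j)).
have gP j : [/\ continuous (g j), periodic (g j), g j (fun=> 0) = x0
      & forall i t, 0 <= t <= 1 -> g j (axis i t) = l (val i) t].
  exact: (projT2 (cid (tor j))).
pose coord j (x : RD) : {ptws I_ j -> R} := fun i => x (Tagged (fun j => I_ j) i).
have coordc j : continuous (coord j).
  by apply: ptws_continuous => i; exact: ptws_eval_continuous.
pose F (x : RD) : {ptws 'I_r -> X} := fun j => g j (coord j x).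
have Fc : continuous F.
  apply: ptws_continuous => j; have [gc _ _ _] := gP j.
  exact: continuous_comp_fun (coordc j) gc.
have Fshift x a : F (shift x a) = F x.
  by apply/funext => j; have [_ gp _ _] := gP j; exact: gp.
have DE : #|{: D}| = (\sum_j #|C j|)%N.
  rewrite card_tagged sumnE big_map big_enum /=; apply: eq_bigr => j _.
  exact: card_sig.
rewrite -DE; apply: (@covering_dimension R D k (fun i => F @^-1` U i)).
- by move=> i; apply: open_comp => // x _; exact: Fc.
- move=> x; have : [set: {ptws 'I_r -> X}] (F x) by [].
  by rewrite -Ucov => -[i _ Ui]; exists i.
- by move=> i x a /=; rewrite Fshift.
move=> i x a [c [cc Wc c0 c1]].
have [s [sc sE]] := Us i.
have [P [Pc Pe Pper]] := section_homotopy sc sE (continuous_comp_fun cc Fc) Wc.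
pose j0 : 'I_r := Ordinal (ltnW r_ge2).
pose aj j (i : I_ j) := a (Tagged (fun j => I_ j) i).
pose A j : {ffun V -> int} := \sum_(i : I_ j) [ffun u => (val i == u)%:R] *~ aj j i.
have classE j : abelianization (phi (line (g j) (aj j))) = A j.
  have [gc gp g0 gl] := gP j.
  rewrite (line_class phi_homotopic phi_concat (@abelianizationM V E) (aj j) gc gp g0 gl).
  by apply: eq_bigr => i' _; rewrite phil abelianization_generator.
have AE j : A j0 = A j.
  rewrite -!classE.
  have [gc gp g0 _] := gP j0; have [gc' gp' g0' _] := gP j.
  pose tj : R := j%:R / r.-1%:R.
  apply: (free_homotopy_class phi_homotopic phi_concat (@abelianizationM V E)
    (c1 := fun t => coord j0 (c t)) (c2 := fun t => coord j (c t))
    (H := fun st => P (st.2, clamp (tj * st.1 + 0)))) => //.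
  - by move=> i'; exact: continuous_comp_fun cc (@ptws_eval_continuous R _ _).
  - by move=> i'; exact: continuous_comp_fun cc (@ptws_eval_continuous R _ _).
  - apply: (continuous_comp_fun (f := fun st : R * R => (st.2, clamp (tj * st.1 + 0)))) => //.
    apply: pair_continuous; first exact: snd_continuous.
    have h := continuous_comp_fun (@affine_continuous R tj 0) (@clamp_continuous R).
    exact: continuous_comp_fun (@fst_continuous R R) h.
  - by move=> i'; rewrite c1 c0.
  - by move=> i'; rewrite c1 c0.
  - move=> t /=; rewrite mulr0 add0r.
    by have := Pe t j0; rewrite mul0r.
  - by move=> t /=; rewrite mulr1 addr0 Pe.
  - by move=> t /=; apply: Pper; rewrite /= c0 c1 Fshift.
have Aval j (i' : I_ j) : A j (val i') = aj j i'.
  rewrite /A sum_ffunE (bigD1 i') //= big1 => [|i2 i2i].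
    by rewrite addr0 ffunMzE ffunE eqxx intz.
  by rewrite ffunMzE ffunE (inj_eq val_inj) (negPf i2i) mul0rz.
have Aout j v : v \notin C j -> A j v = 0.
  move=> vj; rewrite /A sum_ffunE big1 // => i' _.
  rewrite ffunMzE ffunE; case: eqP => [iv|]; last by rewrite mul0rz.
  by rewrite -iv (valP i') in vj.
apply/funext => -[j i']; rewrite -[LHS]/(aj j i') -Aval -AE.
by have [j' vj'] := C_cap (val i'); rewrite (AE j') Aout.
Qed.

End LowerBound.

Unset Implicit Arguments.
Set Strict Implicit.
Set Printing Implicit Defensive.

Theorem mainTheorem5 (R : realType) (V : finType) (E : rel V)
  (E_sym : symmetric E) (E_irr : irreflexive E)
  (r : nat) (r_ge2 : (2 <= r)%N)
  (X : topologicalType) (KX : is_K1 R X (raag E)) :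
  ((zr E r)%:R%:E <= TC R r X)%E.
Proof.
apply: le_ereal_inf_tmp => _ [k kTC <-]; rewrite lee_fin ler_nat.
apply/bigmax_leqP => C /andP[/forallP cl /eqP cap].
apply: (clique_sum_le r_ge2 KX cl _ kTC) => v.
have : v \notin (\bigcap_i C i)%SET by rewrite cap inE.
by move=> /bigcapP h; apply/existsP; rewrite -negb_forall; apply/negP => /forallP h';
  apply: h => j _.
Qed.
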